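(* The map $\phi:\mathbb{R}\mathsf{P}^2(2\sqrt2)\to\mathsf{F}(\mathbb{R}^3)$ defined by $$\phi([x:y:z])=(xi+yj+zk)\,\mathsf{Q}_8,\qquad (x,y,z)\in\mathsf{S}^2(2\sqrt2),$$ is a non-injective inextendable compatible totally geodesic immersion.
   Context: $\mathsf{S}^n(r)$ is the round sphere of radius $r$ in $\mathbb{R}^{n+1}$ and $\mathbb{R}\mathsf{P}^2(r)$ is the quotient of $\mathsf{S}^2(r)$ by the antipodal map; $[x:y:z]$ is the class of $(x,y,z)\in\mathsf{S}^2(2\sqrt2)$. $\mathsf{Q}_8=\{\pm1,\pm i,\pm j,\pm k\}$ acts on $\mathsf{S}^3(2\sqrt2)\subseteq\mathbb{H}\equiv\mathbb{R}^4$ by right quaternionic multiplication. $\mathsf{F}(\mathbb{R}^3)=\mathsf{SO}(3)/(\mathbb{Z}_2\oplus\mathbb{Z}_2)=\mathsf{Sp}(1)/\mathsf{Q}_8$ is the manifold of full flags in $\mathbb{R}^3$, with the metric of constant curvature $1/8$ (the one induced from its totally geodesic embedding as $\mathsf{SO}(3)\cdot o$ in the flag manifold $\mathsf{F}(\mathbb{C}^3)=\mathsf{SU}(3)/\mathsf{T}^2$ with normal homogeneous metric given by $-\operatorname{tr}(XY)$ on $\mathfrak{su}(3)$), and is identified isometrically with $\mathsf{S}^3(2\sqrt2)/\mathsf{Q}_8$. An isometric immersion $f:\Sigma\to M$ of a connected Riemannian manifold is totally geodesic if it maps geodesics to geodesics; it is compatible if $p\mapsto(f(p),f_{*p}(T_p\Sigma))$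 is injective. A compatible totally geodesic immersion $f_2:\Sigma_2\to M$ extends $f_1:\Sigma_1\to M$ if there is an injective local isometry $j:\Sigma_1\to\Sigma_2$ with $f_1=f_2\circ j$; $f$ is inextendable if every compatible totally geodesic immersion extending it is equivalent to it (i.e. $j$ is an isometry onto). *)

(* Defs.v *)
(* Smooth and Riemannian manifolds are not in the libraries.  They are set up
   below as sets with a family of parametrizations by open subsets of R^n; the
   topology is the one induced by the atlas.
   Points of R^n are row vectors, so differentials act on the right:
   f (u + h) = f u + h *m jacobian f u + o(h). *)
From HB Require Import structures.
From mathcomp Require Import all_boot all_order all_algebra generic_quotient.
From mathcomp Require Import all_classical all_reals all_analysis.
From mathcomp Require Import ring.
Set Implicit Arguments.
Unset Strict Implicit.
Unset Printing Implicit Defensive.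
Import Order.TTheory GRing.Theory Num.Theory.
Import numFieldNormedType.Exports.
Local Open Scope classical_set_scope.
Local Open Scope ring_scope.
Local Open Scope quotient_scope.

Section smooth.
Context {R : realType}.

(* Used for open [A] only. *)
Fixpoint Ck (k : nat) (V W : normedModType R) (A : set V) (f : V -> W) : Prop :=
  if k is k'.+1
  then (forall x, A x -> differentiable f x) /\
       (forall v, Ck k' A (fun x => 'D_v f x))
  else forall x, A x -> {for x, continuous f}.

Definition smooth_on (V W : normedModType R) (A : set V) (f : V -> W) : Prop :=
  forall k, Ck k A f.

End smooth.

(* [metric i u] is the Gram matrix of the coordinate frame of [par i] at [u].
   The manifold and metric axioms are in [riemannian_manifold]. *)
Record metricAtlas (R : realType) := MetricAtlas {
  pt :> Type;
  dim : nat;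
  idx : Type;
  dom : idx -> set 'rV[R]_dim;
  par : idx -> 'rV[R]_dim -> pt;
  metric : idx -> 'rV[R]_dim -> 'M[R]_dim;
  dom_open : forall i, open (dom i) }.

Section atlas_topology.
Context {R : realType} (M : metricAtlas R).

HB.instance Definition _ := gen_eqMixin (pt M).
HB.instance Definition _ := gen_choiceMixin (pt M).

Definition atlas_open : set_system (pt M) :=
  [set A | forall i : idx M, open (dom i `&` par i @^-1` A)].

Lemma atlas_openT : atlas_open setT.
Proof. by move=> i; rewrite preimage_setT setIT; exact: dom_open. Qed.

Lemma atlas_openI : setI_closed atlas_open.
Proof.
move=> A B oA oB i; rewrite preimage_setI -(setIid (dom i)) setIACA.
exact: openI.
Qed.

Lemma atlas_open_bigcup (I : Type) (F : I -> set (pt M)) :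
  (forall k, atlas_open (F k)) -> atlas_open (\bigcup_k F k).
Proof.
move=> oF i; rewrite preimage_bigcup setI_bigcupr.
by apply: bigcup_open => k _; exact: oF.
Qed.

HB.instance Definition _ := isOpenTopological.Build (pt M)
  atlas_openT atlas_openI atlas_open_bigcup.

End atlas_topology.

Section manifolds.
Context {R : realType}.
Implicit Types S M N : metricAtlas R.

Definition patch M (i : idx M) : set M := par i @` dom i.

(* the coordinates of the chart [i], meaningful on [patch i] *)
Definition coord M (i : idx M) : M -> 'rV[R]_(dim M) :=
  'pinv_(fun=> 0) (dom i) (par i).

Definition rep S M (f : S -> M) (i : idx S) (j : idx M) :
    'rV[R]_(dim S) -> 'rV[R]_(dim M) :=
  coord j \o f \o par i.

Definition rep_dom S M (A : set S) (f : S -> M) (i : idx S) (j : idx M) :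
    set 'rV[R]_(dim S) :=
  dom i `&` par i @^-1` (A `&` f @^-1` patch j).

(* For open [A].  Openness of the sets [rep_dom A f i j] amounts to continuity
   of [f] on [A]. *)
Definition msmooth_on S M (A : set S) (f : S -> M) : Prop :=
  forall i j, open (rep_dom A f i j) /\ smooth_on (rep_dom A f i j) (rep f i j).

Definition preserves_metric S M (f : S -> M) : Prop :=
  forall (i : idx S) (j : idx M) u, rep_dom setT f i j u ->
    let J := jacobian (rep f i j) u in
    metric i u = J *m metric j (rep f i j u) *m J^T.

(* For the identity, [rep] is the family of transition maps of the atlas. *)
Definition smooth_manifold M : Prop :=
  [/\ forall i : idx M, {in dom i &, injective (par i)},
      forall p : M, exists i : idx M, patch i p,
      msmooth_on setT (@id M),
      hausdorff_space M
    & @second_countable M].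

Definition riemannian_manifold M : Prop :=
  [/\ smooth_manifold M,
      forall i : idx M, smooth_on (dom i) (metric i),
      forall (i : idx M) u, dom i u -> (metric i u)^T = metric i u,
      forall (i : idx M) u, dom i u -> forall h : 'rV[R]_(dim M), h != 0 ->
        0 < (h *m metric i u *m h^T) 0 0
    & preserves_metric (@id M)].

(* A tangent vector is the family of its components in all charts at [p]
   (extended by 0 to the other charts), with the usual transformation law. *)
Definition tangent M (p : M) : set (idx M -> 'rV[R]_(dim M)) :=
  [set v | (forall i, ~ patch i p -> v i = 0) /\
           (forall i j, patch i p -> patch j p ->
              v j = v i *m jacobian (rep (@id M) i j) (coord i p))].

Definition tangent_image S M (f : S -> M) (p : S) :
    set (idx M -> 'rV[R]_(dim M)) :=
  [set w | tangent (f p) w /\ exists2 v, tangent p v &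
    forall i j, patch i p -> patch j (f p) ->
      w j = v i *m jacobian (rep f i j) (coord i p)].

Definition partial M (i : idx M) (a b c : 'I_(dim M)) (u : 'rV[R]_(dim M)) : R :=
  'D_(delta_mx 0 a) (fun v => metric i v b c) u.

Definition christoffel M (i : idx M) (u : 'rV[R]_(dim M))
    (k a b : 'I_(dim M)) : R :=
  2^-1 * \sum_l invmx (metric i u) k l *
    (partial i a b l u + partial i b a l u - partial i l a b u).

Definition geodesic M (I : set R) (g : R -> M) : Prop :=
  [/\ open I, is_interval I
    & forall i : idx M,
        let W := I `&` g @^-1` patch i in
        let c : R -> 'rV[R]_(dim M) := coord i \o g in
        [/\ open W, smooth_on (W : set R^o) (c : R^o -> 'rV[R]_(dim M))
          & forall t, W t -> forall k,
              derive1n 2 c t 0 k + \sum_a \sum_b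
                christoffel i (c t) k a b * derive1 c t 0 a * derive1 c t 0 b = 0]].

Definition isometric_immersion S M (f : S -> M) : Prop :=
  [/\ msmooth_on setT f,
      forall (i : idx S) (j : idx M) u, rep_dom setT f i j u ->
        row_free (jacobian (rep f i j) u)
    & preserves_metric f].

Definition totally_geodesic_immersion S M (f : S -> M) : Prop :=
  [/\ riemannian_manifold S, connected [set: S], riemannian_manifold M,
      isometric_immersion f
    & forall I g, geodesic I g -> geodesic I (f \o g)].

Definition compatible S M (f : S -> M) : Prop :=
  injective (fun p => (f p, tangent_image f p)).

Definition local_isometry S M (f : S -> M) : Prop :=
  preserves_metric f /\
  forall p, exists (U : set S) (V : set M) (h : M -> S),
    [/\ open U, open V & U p] /\
    [/\ msmooth_on U f, msmooth_on V h,
        forall x, U x -> V (f x) /\ h (f x) = x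
      & forall y, V y -> U (h y) /\ f (h y) = y].

Definition isometry S M (f : S -> M) : Prop :=
  exists h : M -> S, [/\ msmooth_on setT f, msmooth_on setT h,
                         cancel f h, cancel h f & preserves_metric f].

Definition extension_by S1 S2 M (f1 : S1 -> M) (f2 : S2 -> M) (j : S1 -> S2) :
    Prop :=
  [/\ injective j, local_isometry j & f1 = f2 \o j].

Definition inextendable S M (f : S -> M) : Prop :=
  forall (S' : metricAtlas R) (f' : S' -> M) (j : S -> S'),
    totally_geodesic_immersion f' -> compatible f' ->
    extension_by f f' j -> isometry j.

End manifolds.

Section sphere.
Context {R : realType}.

(* Not [`|x|], which is the sup norm on matrices. *)
Definition sqnorm n (x : 'rV[R]_n) : R := \sum_i x 0 i ^+ 2.

Definition sphere n (r : R) : Type := {x : 'rV[R]_n.+1 | sqnorm x == r ^+ 2}.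

HB.instance Definition _ n r := Choice.on (sphere n r).

Lemma sqnorm_ge0 n (x : 'rV[R]_n) : 0 <= sqnorm x.
Proof. by apply: sumr_ge0 => i _; rewrite sqr_ge0. Qed.

Lemma sqnormE n (x : 'rV[R]_n) : sqnorm x = (x *m x^T) 0 0.
Proof. by rewrite mxE; apply: eq_bigr => i _; rewrite !mxE expr2. Qed.

Lemma sqnormZ n (a : R) (x : 'rV[R]_n) : sqnorm (a *: x) = a ^+ 2 * sqnorm x.
Proof. by rewrite mulr_sumr; apply: eq_bigr => i _; rewrite mxE exprMn. Qed.

Lemma sqnorm_continuous n : continuous (@sqnorm n).
Proof.
apply: continuous_big => [|i _ x]; first exact: add_continuous.
by apply: continuousM; exact: coord_continuous.
Qed.

Lemma open_unit_ball n : open [set u : 'rV[R]_n | sqnorm u < 1].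
Proof.
rewrite (_ : mkset _ = (@sqnorm n) @^-1` [set y | y < 1])//.
by apply: open_comp => [x _|]; [exact: sqnorm_continuous|exact: open_lt].
Qed.

Definition orthogonal_frame n : Type := {B : 'M[R]_n | B *m B^T == 1%:M}.

(* The central projection of the affine hyperplane 1 x R^n onto the sphere,
   moved by the orthogonal matrix [B]. *)
Definition gnomonic n (r : R) (B : 'M[R]_n.+1) (u : 'rV[R]_n) : 'rV[R]_n.+1 :=
  (r / Num.sqrt (1 + sqnorm u)) *: (row_mx (1%:M : 'M[R]_1) u *m B).

Lemma gnomonic_sphere n r (B : orthogonal_frame n.+1) (u : 'rV[R]_n) :
  sqnorm (gnomonic r (sval B) u) == r ^+ 2.
Proof.
case: B => B /= /eqP BB.
have u0 : 0 < 1 + sqnorm u by rewrite ltr_pwDl // sqnorm_ge0.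
rewrite /gnomonic sqnormZ [sqnorm (_ *m _)]sqnormE trmx_mul mulmxA.
rewrite -[_ *m B *m _]mulmxA BB mulmx1.
rewrite tr_row_mx mul_row_col trmx1 mulmx1 mxE -sqnormE mxE eqxx.
by rewrite exprMn exprVn sqr_sqrtr ?(ltW u0)// divfK ?(gt_eqF u0).
Qed.

Definition gnomonic_pt n r (B : orthogonal_frame n.+1) (u : 'rV[R]_n) :
  sphere n r := exist _ (gnomonic r (sval B) u) (gnomonic_sphere r B u).

(* The quotient of the round sphere of radius r by [e], with the metric making
   the projection a local isometry: the charts are the central projections of
   unit balls followed by the projection, and the metric is the pullback of the
   Euclidean one by the lift to the sphere.  Unit balls are mapped to spherical
   caps of angular radius pi / 4, so the charts are injective when, as below,
   [e] is given by a group of isometries that move every point by at least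
   pi / 2. *)
Definition sphere_quotient n (r : R) (e : equiv_rel (sphere n r)) :
    metricAtlas R :=
  @MetricAtlas R {eq_quot e} n (orthogonal_frame n.+1)
    (fun=> [set u | sqnorm u < 1])
    (fun B u => \pi_{eq_quot e} (gnomonic_pt r B u))
    (fun B u => let J := jacobian (gnomonic r (sval B)) u in J *m J^T)
    (fun=> @open_unit_ball n).

Definition antipodal n r : rel (sphere n r) :=
  fun x y => (val y == val x) || (val y == - val x).

Lemma antipodal_equiv n r : equiv_class_of (@antipodal n r).
Proof.
split=> [x|x y|y x z]; rewrite /antipodal ?eqxx//.
  by rewrite eq_sym; congr (_ || _); rewrite -eqr_oppLR eq_sym.
by move=> /orP[]/eqP-> /orP[]/eqP->; rewrite ?opprK eqxx ?orbT.
Qed.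

Definition antipodal_rel n r : equiv_rel (sphere n r) :=
  EquivRelPack (@antipodal_equiv n r).

Definition RPn n r : metricAtlas R := sphere_quotient (antipodal_rel n r).

End sphere.

Section quaternions.
Context {R : realType}.
Implicit Types (p q : 'rV[R]_4).

(* a + b i + c j + d k *)
Definition quat (a b c d : R) : 'rV[R]_4 := \row_i [:: a; b; c; d]`_i.

Definition qmul p q : 'rV[R]_4 :=
  let a := p 0 0 in let b := p 0 1 in let c := p 0 2%:R in let d := p 0 3%:R in
  let a' := q 0 0 in let b' := q 0 1 in
  let c' := q 0 2%:R in let d' := q 0 3%:R in
  quat (a * a' - b * b' - c * c' - d * d')
       (a * b' + b * a' + c * d' - d * c')
       (a * c' - b * d' + c * a' + d * b')
       (a * d' + b * c' - c * b' + d * a').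

Definition Q8 : seq 'rV[R]_4 :=
  [:: quat 1 0 0 0; quat (-1) 0 0 0; quat 0 1 0 0; quat 0 (-1) 0 0;
      quat 0 0 1 0; quat 0 0 (-1) 0; quat 0 0 0 1; quat 0 0 0 (-1)].

Lemma qmul_quat a b c d a' b' c' d' :
  qmul (quat a b c d) (quat a' b' c' d') =
  quat (a * a' - b * b' - c * c' - d * d')
       (a * b' + b * a' + c * d' - d * c')
       (a * c' - b * d' + c * a' + d * b')
       (a * d' + b * c' - c * b' + d * a').
Proof. by rewrite /qmul !mxE. Qed.

Lemma quatE p : p = quat (p 0 0) (p 0 1) (p 0 2%:R) (p 0 3%:R).
Proof.
apply/rowP => i; rewrite !mxE.
by case: i => -[|[|[|[|//]]]] i /=; congr (p 0 _); apply/val_inj.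
Qed.

Lemma sqnorm_quat a b c d :
  sqnorm (quat a b c d) = a ^+ 2 + b ^+ 2 + c ^+ 2 + d ^+ 2.
Proof. by rewrite /sqnorm !big_ord_recr big_ord0 !mxE/= add0r. Qed.

Lemma qmulA p q s : qmul p (qmul q s) = qmul (qmul p q) s.
Proof.
rewrite (quatE p) (quatE q) (quatE s) !qmul_quat.
by congr quat; ring.
Qed.

Lemma qmul1 p : qmul p (quat 1 0 0 0) = p.
Proof. by rewrite [RHS]quatE (quatE p) qmul_quat !mxE/=; congr quat; ring. Qed.

Lemma Q8_ind (P : 'rV[R]_4 -> Prop) :
  P (quat 1 0 0 0) -> P (quat (-1) 0 0 0) ->
  P (quat 0 1 0 0) -> P (quat 0 (-1) 0 0) ->
  P (quat 0 0 1 0) -> P (quat 0 0 (-1) 0) ->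
  P (quat 0 0 0 1) -> P (quat 0 0 0 (-1)) -> {in Q8, forall q, P q}.
Proof.
move=> ? ? ? ? ? ? ? ? q; rewrite !inE.
by do 7?[case/orP=> [/eqP->//|]]; move/eqP->.
Qed.

Lemma Q8M : {in Q8 &, forall p q, qmul p q \in Q8}.
Proof.
move=> p + pQ; move: p pQ.
by apply: Q8_ind; apply: Q8_ind; rewrite qmul_quat
  !(mulr0, mul0r, mulr1, mul1r, mulrN, mulNr, subr0, addr0, add0r, sub0r,
    opprK, oppr0) !inE eqxx ?orbT.
Qed.

Lemma Q8V : {in Q8, forall q,
  exists2 q', q' \in Q8 & forall p, qmul (qmul p q) q' = p}.
Proof.
move=> q qQ; exists (quat (q 0 0) (- q 0 1) (- q 0 2%:R) (- q 0 3%:R)).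
  by move: q qQ; apply: Q8_ind; rewrite !mxE/= ?(opprK, oppr0) !inE eqxx ?orbT.
move=> p; rewrite -qmulA -[RHS]qmul1; congr qmul.
by move: q qQ; apply: Q8_ind; rewrite !mxE/= qmul_quat; congr quat; ring.
Qed.

Definition Q8_orbit r : rel (@sphere R 3 r) :=
  fun x y => has (fun q => val y == qmul (val x) q) Q8.

Lemma Q8_equiv r : equiv_class_of (@Q8_orbit r).
Proof.
have sym x y : @Q8_orbit r x y -> @Q8_orbit r y x.
  move=> /hasP[q /Q8V[q' q'Q qq'] /eqP yE].
  by apply/hasP; exists q' => //; rewrite yE qq'.
split=> [x|x y|y x z].
- by apply/hasP; exists (quat 1 0 0 0); rewrite ?qmul1 ?inE ?eqxx.
- by apply/idP/idP; exact: sym.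
- move=> /hasP[p pQ /eqP yE] /hasP[q qQ /eqP zE].
  by apply/hasP; exists (qmul p q); rewrite ?Q8M// zE yE qmulA.
Qed.

Definition Q8_rel r : equiv_rel (@sphere R 3 r) := EquivRelPack (@Q8_equiv r).

End quaternions.

Section phi.
Context {R : realType}.

Definition radius : R := 2 * Num.sqrt 2.

Definition RP2 : metricAtlas R := RPn 2 radius.

(* The orbits of right multiplication by Q8 are the left cosets p Q8, so this is
   the manifold of full flags F(R^3) = Sp(1)/Q8 with its metric of constant
   curvature 1/8, in its isometric model S^3(2 sqrt 2)/Q8. *)
Definition flagR3 : metricAtlas R := sphere_quotient (Q8_rel radius).

Definition RP2_class (p : sphere 2 radius) : RP2 :=
  \pi_{eq_quot (antipodal_rel 2 radius)} p.

Definition flag_class (p : sphere 3 radius) : flagR3 :=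
  \pi_{eq_quot (Q8_rel radius)} p.

(* x i + y j + z k *)
Definition imq (p : 'rV[R]_3) : 'rV[R]_4 := quat 0 (p 0 0) (p 0 1) (p 0 2%:R).

Lemma imq_sphere (p : sphere 2 radius) : sqnorm (imq (val p)) == radius ^+ 2.
Proof.
case: p => p /= /eqP <-; rewrite sqnorm_quat /sqnorm !big_ord_recr big_ord0/=.
rewrite expr0n/= !add0r; apply/eqP.
by congr (_ ^+ 2 + _ ^+ 2 + _ ^+ 2); congr (p 0 _); apply/val_inj.
Qed.

Definition imq_pt (p : sphere 2 radius) : sphere 3 radius :=
  exist _ (imq (val p)) (imq_sphere p).

Definition phi (c : RP2) : flagR3 :=
  flag_class (imq_pt (repr (c : {eq_quot (antipodal_rel 2 radius)}))).

Lemma phiE p : phi (RP2_class p) = flag_class (imq_pt p).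
Proof.
apply/eqmodP/hasP => /=.
have /eqmodP/orP := reprK (\pi_{eq_quot (antipodal_rel 2 radius)} p).
rewrite -/(RP2_class p); set p' := repr _.
case=> /eqP ->; last first.
  exists (quat (-1) 0 0 0); first by rewrite !inE eqxx ?orbT.
  by rewrite /imq qmul_quat !mxE; apply/eqP; congr quat; ring.
by exists (quat 1 0 0 0); rewrite ?qmul1 ?inE ?eqxx.
Qed.

End phi.

(* Main.v *)
(* In homogeneous coordinates the central projection charts of a quotient of a
   sphere are linear, so the map induced by an isometric linear embedding [E]
   reads [u |-> b / a] with [(a, b) = (1, u) L] and [L] an isometry.  This gives
   smooth transition maps ([E = 1]) and the smoothness of phi ([E] the inclusion
   of the imaginary quaternions).  In these charts the Christoffel symbols are
   [- (u_a d_kb + u_b d_ka) / (1 + |u|^2)], so geodesics satisfy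
   [X'' = 2 <X, X'> / |X|^2 X'] with [X = (1, u)]; this equation is invariant
   under [L] and under rescaling, hence geodesics go to geodesics.
   phi identifies [x] and [y] when [y = x q] with [q] in Q8, for instance
   [j = i (- k)]; if [q] is not 1 or -1 it is tangent to the imaginary sphere at
   [x], but its image [q q = - 1] at [y] is not, so the tangent planes differ.
   Finally an injective local isometry from the compact RP2 to a connected
   manifold is onto. *)
From HB Require Import structures.
Require Import Defs.
From mathcomp Require Import all_boot all_order all_algebra generic_quotient.
From mathcomp Require Import all_classical all_reals all_analysis.
From mathcomp Require Import ring lra.
(* [coord] and [patch] are shadowed by the libraries. *)
Import Defs.
Set Implicit Arguments.
Unset Strict Implicit.
Unset Printing Implicit Defensive.
Import Order.TTheory GRing.Theory Num.Theory.
Import numFieldNormedType.Exports.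
Local Open Scope classical_set_scope.
Local Open Scope ring_scope.
Local Open Scope quotient_scope.

(** * Smooth functions *)

Section smooth_calculus.
Context {R : realType}.

(** A map between quotients has no single formula in a pair of charts: which representative of the
    image falls into the cap of the target chart depends on the point. Each quotient is therefore
    given by a finite list of orthogonal matrices, and in charts [B], [C] the map is covered by
    branches [chart_map B G C], one for each matrix [G] of the target, each on an open set.
    Smoothness, preservation of the metric and the geodesic equation are local, so each of them is
    checked on one branch at a time.

    The link with the ambient space is [jacobian_induced]: the Jacobian of the map followed by the
    differential of the target parametrization is the differential of the lift [x |-> x E G]. It
    serves twice, for the metric and for the comparison of tangent planes.

    The global topology of the quotients comes from [qnorm], the class of the radial projection,
    which is continuous on the ambient space away from the origin; compactness, connectedness and
    second countability are transported along it. *)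

Lemma near_eq_differentiable (V W : normedModType R) (f g : V -> W) x :
  {near x, f =1 g} -> differentiable f x -> differentiable g x.
Proof.
move=> fg /diff_locallyP[dfc dfo].
(* [g] inherits the first-order expansion of [f]; uniqueness of the differential then identifies
   ['d g x] with ['d f x]. *)
have dgo : g \o shift x = cst (g x) + 'd f x +o_ (0 : V) id.
  apply/eqaddoP => e e0; have /eqaddoP/(_ e e0) := dfo.
  have fg0 : \forall h \near (0 : V), f (h + x) = g (h + x).
    by move: fg; rewrite (near_shift 0)/= subr0.
  have fgx : f x = g x := nbhs_singleton fg.
  apply: filterS2 fg0 => h fgh; rewrite /= !fctE /= fgh -fgx; exact.
have dgE := diff_unique dfc dgo.
by apply/diff_locallyP; rewrite dgE.
Qed.

Lemma Ck_congr k (V W : normedModType R) (A : set V) (f g : V -> W) :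
  open A -> (forall x, A x -> f x = g x) -> Ck k A f -> Ck k A g.
Proof.
move=> oA; have nearA (f' g' : V -> W) x : (forall x, A x -> f' x = g' x) ->
    A x -> {near x, f' =1 g'}.
  move=> fg Ax; apply: filterS fg _; exact: open_nbhs_nbhs.
elim: k f g => [|k IH] f g fg /=.
  move=> cf x Ax; rewrite /prop_for /continuous_at -(fg x Ax).
  by apply: cvg_trans (cf x Ax); apply: near_eq_cvg; exact: nearA.
move=> [df Df]; split => [x Ax|v].
  by apply: near_eq_differentiable (df x Ax); exact: nearA.
apply: IH (Df v) => x Ax; apply: near_eq_derive; exact: nearA.
Qed.

(** The product rule involves the factors themselves beside their derivatives, so inductions on the
    order have to lower it. *)
Lemma CkW k (V W : normedModType R) (A : set V) (f : V -> W) :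
  Ck k.+1 A f -> Ck k A f.
Proof.
elim: k f => [|k IH] f /= [df Df].
  by move=> x Ax; exact: differentiable_continuous (df x Ax).
by split=> // v; apply: IH; exact: Df.
Qed.

Lemma Ck_local k (V W : normedModType R) (A : set V) (f : V -> W) :
  (forall x, A x -> exists2 B : set V, B x & Ck k B f) -> Ck k A f.
Proof.
elim: k f => [|k IH] f loc /=.
  by move=> x /loc[B Bx]; exact.
split=> [x /loc[B Bx [+ _]]|v]; first exact.
by apply: IH => x /loc[B Bx [_ Df]]; exists B => //; exact: Df.
Qed.

Lemma Ck_cst k (V W : normedModType R) (A : set V) (w : W) :
  Ck k A (fun _ : V => w).
Proof.
elim: k w => [|k IH] w /=; first by move=> x _; exact: cst_continuous.
split=> [x _|v]; first exact: differentiable_cst.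
rewrite (_ : 'D_v _ = fun=> 0); first exact: IH.
by apply/funext => x; rewrite derive_cst.
Qed.

Lemma CkD k (V W : normedModType R) (A : set V) (f g : V -> W) :
  open A -> Ck k A f -> Ck k A g -> Ck k A (fun x => f x + g x).
Proof.
move=> oA; elim: k f g => [|k IH] f g /=.
  by move=> cf cg x Ax; apply: continuousD; [exact: cf|exact: cg].
move=> [df Df] [dg Dg]; split=> [x Ax|v].
  by apply: differentiableD; [exact: df|exact: dg].
apply: (Ck_congr oA _ (IH _ _ (Df v) (Dg v))) => x Ax.
by rewrite [RHS]deriveD//; apply: diff_derivable; [exact: df|exact: dg].
Qed.

Lemma CkM k (V : normedModType R) (A : set V) (f g : V -> R) :
  open A -> Ck k A f -> Ck k A g -> Ck k A (fun x => f x * g x).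
Proof.
move=> oA; elim: k f g => [|k IH] f g /=.
  by move=> cf cg x Ax; apply: continuousM; [exact: cf|exact: cg].
move=> Cf Cg; have [df Df] := Cf; have [dg Dg] := Cg; split=> [x Ax|v].
  by apply: differentiableM; [exact: df|exact: dg].
apply: (Ck_congr oA _ (CkD oA (IH _ _ (CkW Cf) (Dg v)) (IH _ _ (CkW Cg) (Df v)))).
move=> x Ax.
by rewrite [RHS]deriveM//; apply: diff_derivable; [exact: df|exact: dg].
Qed.

(** The derivative [- f^-2 * 'D_v f] contains the inverse again, but only to the order covered by
    the induction hypothesis. *)
Lemma CkV k (V : normedModType R) (A : set V) (f : V -> R) :
  open A -> (forall x, A x -> f x != 0) -> Ck k A f -> Ck k A (fun x => (f x)^-1).
Proof.
move=> oA f0; elim: k => [|k IH] /=.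
  by move=> cf x Ax; apply: cvgV; [exact: f0|exact: cf].
move=> Cf; have [df Df] := Cf; split=> [x Ax|v].
  by apply: differentiableV; [exact: df|exact: f0].
have CV := IH (CkW Cf).
have CN := CkM oA (CkM oA (Ck_cst k A (-1 : R)) (CkM oA CV CV)) (Df v).
apply: (Ck_congr oA _ CN).
move=> x Ax; rewrite [RHS]deriveV ?f0//; last exact: diff_derivable (df _ _).
by rewrite mulN1r -exprVn expr2.
Qed.

Lemma CkZl k (V W : normedModType R) (A : set V) (f : V -> R) (w : W) :
  open A -> Ck k A f -> Ck k A (fun x => f x *: w).
Proof.
move=> oA; elim: k f => [|k IH] f /=.
  by move=> cf x Ax; apply: cvgZr_tmp; exact: cf.
move=> [df Df]; split=> [x Ax|v]; first by apply: differentiableZl; exact: df.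
apply: (Ck_congr oA _ (IH _ (Df v))) => x Ax.
rewrite deriveE; last exact: df.
rewrite [RHS]deriveE; last by apply: differentiableZl; exact: df.
by rewrite diffZl//; exact: df.
Qed.

Lemma Ck_sum k (V W : normedModType R) (A : set V) (I : Type) (r : seq I)
    (P : pred I) (F : I -> V -> W) :
  open A -> (forall i, Ck k A (F i)) ->
  Ck k A (fun x => \sum_(i <- r | P i) F i x).
Proof.
move=> oA CF; elim: r => [|i r IH].
  apply: Ck_congr (Ck_cst k A 0) => // x _; by rewrite big_nil.
case Pi: (P i).
  by apply: Ck_congr (CkD oA (CF i) IH) => // x _; rewrite big_cons Pi.
by apply: Ck_congr IH => // x _; rewrite big_cons Pi.
Qed.

Lemma Ck_mx k (V : normedModType R) m n (A : set V) (f : V -> 'M[R]_(m, n)) :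
  open A -> (forall i j, Ck k A (fun x => f x i j)) -> Ck k A f.
Proof.
move=> oA Cf.
apply: (@Ck_congr k _ _ _
  (fun x => \sum_i \sum_j f x i j *: (delta_mx i j : 'M[R]_(m, n)))) => //.
  by move=> x _; rewrite -matrix_sum_delta.
apply: Ck_sum => // i; apply: Ck_sum => // j; exact: CkZl.
Qed.

Lemma Ck_coord k m n (A : set 'M[R]_(m, n)) i j :
  open A -> Ck k A (fun x => x i j : R).
Proof.
move=> oA; case: k => [|k] /=; first by move=> x _; exact: coord_continuous.
split=> [x _|v]; first exact: differentiable_coord.
apply: (Ck_congr oA _ (Ck_cst k A (v i j))) => x _.
have /(congr1 (fun M : 'M[R]_(m, n) => M i j)) := derive_id x v.
by rewrite derive_mx ?mxE// => /esym; exact.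
Qed.

Lemma Ck_comp_coord k (V : normedModType R) m n (A : set V)
    (f : V -> 'M[R]_(m, n)) i j :
  open A -> Ck k A f -> Ck k A (fun x => f x i j : R).
Proof.
move=> oA; elim: k f => [|k IH] f /=.
  move=> cf x Ax.
  apply: (@continuous_comp _ _ _ f (fun M : 'M[R]_(m, n) => M i j) x (cf x Ax)).
  exact: coord_continuous.
move=> [df Df]; split=> [x Ax|v].
  apply: (@differentiable_comp _ _ _ _ f (fun M : 'M[R]_(m, n) => M i j : R)).
    exact: df.
  exact: differentiable_coord.
apply: (Ck_congr oA _ (IH _ (Df v))) => x Ax.
by rewrite derive_mx ?mxE//; apply: diff_derivable; exact: df.
Qed.

Lemma smooth_on_congr (V W : normedModType R) (A : set V) (f g : V -> W) :
  open A -> (forall x, A x -> f x = g x) -> smooth_on A f -> smooth_on A g.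
Proof. by move=> oA fg sf k; exact: Ck_congr (sf k). Qed.

Lemma smooth_on_local (V W : normedModType R) (A : set V) (f : V -> W) :
  (forall x, A x -> exists2 B : set V, B x & smooth_on B f) -> smooth_on A f.
Proof.
by move=> loc k; apply: Ck_local => x /loc[B Bx Bf]; exists B.
Qed.

Lemma smooth_on_continuous (V W : normedModType R) (A : set V) (f : V -> W) x :
  smooth_on A f -> A x -> {for x, continuous f}.
Proof. by move=> /(_ 0%N); exact. Qed.

Lemma smooth_on_differentiable (V W : normedModType R) (A : set V)
  (f : V -> W) x : smooth_on A f -> A x -> differentiable f x.
Proof. by move=> /(_ 1%N)[+ _]; exact. Qed.

Lemma jacobianE m n (f : 'rV[R]_m -> 'rV[R]_n) (x h : 'rV[R]_m) :
  h *m jacobian f x = 'd f x h.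
Proof. by rewrite /jacobian mul_rV_lin1. Qed.

Lemma near_eq_jacobian m n (f g : 'rV[R]_m -> 'rV[R]_n) (x : 'rV[R]_m) :
  differentiable f x -> {near x, f =1 g} -> jacobian f x = jacobian g x.
Proof.
move=> df fg; have dg := near_eq_differentiable fg df.
apply/row_matrixP => i; apply: etrans (rowE _ _) (etrans _ (esym (rowE _ _))).
apply: etrans (esym (deriveEjacobian _ df)) (etrans _ (deriveEjacobian _ dg)).
exact: near_eq_derive.
Qed.

Lemma jacobian_comp m n p (f : 'rV[R]_m -> 'rV[R]_n) (g : 'rV[R]_n -> 'rV[R]_p)
    (x : 'rV[R]_m) :
  differentiable f x -> differentiable g (f x) ->
  jacobian (g \o f) x = jacobian f x *m jacobian g (f x).
Proof.
move=> df dg; apply/row_matrixP => i; rewrite !rowE mulmxA !jacobianE.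
by rewrite diff_comp.
Qed.

Lemma differentiable_mulmxr n p (L : 'M[R]_(n, p)) (x : 'rV[R]_n) :
  differentiable (fun u : 'rV[R]_n => u *m L) x.
Proof.
apply: (@smooth_on_differentiable _ _ setT) => // k.
apply: Ck_mx => [|i j]; first exact: openT.
apply: (@Ck_congr k _ _ _ (fun u : 'rV[R]_n => \sum_l u i l * L l j)).
- exact: openT.
- by move=> u _; rewrite mxE.
- apply: Ck_sum => [|l]; first exact: openT.
  by apply: CkM; [exact: openT|apply: Ck_coord; exact: openT|exact: Ck_cst].
Qed.

Lemma jacobian_mulmxr m n p (f : 'rV[R]_m -> 'rV[R]_n) (L : 'M[R]_(n, p))
    (x : 'rV[R]_m) :
  differentiable f x ->
  jacobian (fun u => f u *m L) x = jacobian f x *m L.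
Proof.
(* The differential of a linear map is the map itself once it is known to be continuous;
   differentiability supplies this. *)
move=> df; have dL := differentiable_mulmxr L.
rewrite (_ : (fun u => _) = (fun v : 'rV_n => v *m L) \o f)//.
rewrite jacobian_comp//; congr (_ *m _).
apply/row_matrixP => i; rewrite !rowE jacobianE.
pose f' : {linear 'rV[R]_n -> 'rV[R]_p} := mulmxr L.
have -> : (fun v : 'rV_n => v *m L) = f' by [].
have cf' : continuous f' by move=> u; exact: differentiable_continuous (dL u).
by rewrite diff_lin.
Qed.

End smooth_calculus.

(** * Manifolds and local isometries *)

Section charts.
Context {R : realType}.
Implicit Types S M N : metricAtlas R.

Lemma near_open (T : topologicalType) (A : set T) (x : T) :
  open A -> A x -> \near x, A x.
Proof. by move=> oA Ax; apply: open_nbhs_nbhs; split. Qed.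

Lemma openP (T : topologicalType) (A : set T) :
  (forall x, A x -> \near x, A x) -> open A.
Proof. by move=> nA; rewrite openE. Qed.

Section manifold.
Context {M} (mM : smooth_manifold M).

Lemma coord_par (i : idx M) u : dom i u -> coord i (par i u) = u.
Proof. by case: mM => inj _ _ _ _ iu; rewrite /coord pinvKV ?inE. Qed.

Lemma par_coord (i : idx M) p : patch i p -> par i (coord i p) = p.
Proof. by move=> pp; rewrite /coord pinvK ?inE. Qed.

Lemma dom_coord (i : idx M) p : patch i p -> dom i (coord i p).
Proof. by move=> [u iu <-]; rewrite coord_par. Qed.

Lemma chart_at p : exists i : idx M, patch i p.
Proof. by case: mM. Qed.

End manifold.

Lemma par_rep S M (f : S -> M) (i : idx S) (j : idx M) u :
  patch j (f (par i u)) -> par j (rep f i j u) = f (par i u).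
Proof. by move=> jf; rewrite /rep /= par_coord. Qed.

Lemma rep_dom_coord S M (f : S -> M) (i : idx S) (j : idx M) p :
  smooth_manifold S -> patch i p -> patch j (f p) ->
  rep_dom setT f i j (coord i p).
Proof.
move=> mS ip jfp; split; first exact: dom_coord.
by rewrite /preimage /= par_coord.
Qed.

Lemma msmooth_on_congr S M (A : set S) (f g : S -> M) :
  (forall x, A x -> f x = g x) -> msmooth_on A f -> msmooth_on A g.
Proof.
move=> fg sf i j; have [oD sD] := sf i j.
have DE : rep_dom A f i j = rep_dom A g i j.
  by apply/seteqP; split=> u [iu [/= Au]]; rewrite /preimage /= ?fg// => jfu;
    (split; [|split]) => //=; rewrite ?fg// -fg.
rewrite -DE; split => //; apply: (smooth_on_congr oD _ sD) => u [_ [/= Au _]].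
by rewrite /rep /= fg.
Qed.

(** Openness of [rep_dom U f i j] is part of [msmooth_on U f], so these sets serve as the
    neighbourhoods on which [f] is represented smoothly. *)
Lemma msmooth_on_local S M (f : S -> M) :
  (forall p, exists2 U : set S, U p & msmooth_on U f) -> msmooth_on setT f.
Proof.
move=> loc i j; split.
  apply: openP => u [iu [_ /= jfu]].
  have [U Uu /(_ i j)[oU _]] := loc (par i u).
  have : \near u, rep_dom U f i j u by apply: near_open.
  by apply: filterS => v [iv [_ jfv]].
apply: smooth_on_local => u [iu [_ /= jfu]].
have [U Uu /(_ i j)[oU sU]] := loc (par i u).
by exists (rep_dom U f i j).
Qed.

(** The topology being that of the atlas, openness is tested in a chart of [S], and near a given
    point one chart of [M] around its image is enough. *)
Lemma msmooth_on_continuous S M (A : set S) (f : S -> M) (V : set M) :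
  smooth_manifold M -> msmooth_on A f -> open V -> open (A `&` f @^-1` V).
Proof.
move=> mM sf oV; suff: atlas_open (A `&` f @^-1` V) by [].
move=> i; apply: openP => u [iu [Au /= Vfu]].
have [k kfu] := chart_at mM (f (par i u)).
have [oD sD] := sf i k.
have Du : rep_dom A f i k u by [].
have cu := smooth_on_continuous sD Du.
have nV : \forall v \near rep f i k u, (dom k `&` par k @^-1` V) v.
  apply: near_open; first exact: oV.
  split; first exact: dom_coord.
  by rewrite /preimage /= par_rep.
have nD : \near u, rep_dom A f i k u by apply: near_open.
apply: filterS2 nD (cu _ nV) => v [iv [Av /= kfv]] [_ /=].
by rewrite /preimage /= par_rep.
Qed.

Lemma rep_comp S M N (f : S -> M) (g : M -> N) (i : idx S) (j : idx M)
    (k : idx N) u :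
  patch j (f (par i u)) ->
  rep (g \o f) i k u = rep g j k (rep f i j u).
Proof. by move=> jfu; rewrite {2}/rep /= par_rep. Qed.

Lemma rep_differentiable S M (f : S -> M) (i : idx S) (j : idx M) u :
  msmooth_on setT f -> rep_dom setT f i j u -> differentiable (rep f i j) u.
Proof. by move=> /(_ i j)[_ sf]; exact: smooth_on_differentiable. Qed.

(** The chain rule: [rep (g \o f) i k] is the composite of the two representatives only as long as
    [f] stays in the patch of [j], which is the case near [u]. *)
Lemma jacobian_rep_comp S M N (f : S -> M) (g : M -> N) (i : idx S) (j : idx M)
    (k : idx N) u :
  smooth_manifold M -> msmooth_on setT f -> msmooth_on setT g ->
  rep_dom setT f i j u -> patch k (g (f (par i u))) ->
  jacobian (rep (g \o f) i k) u =
  jacobian (rep f i j) u *m jacobian (rep g j k) (rep f i j u).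
Proof.
move=> mM sf sg fu gfu; have [iu [_ jfu]] := fu.
have df := rep_differentiable sf fu.
have gfu' : rep_dom setT g j k (rep f i j u).
  split; first exact: dom_coord.
  by rewrite /preimage /= par_rep.
have dg := rep_differentiable sg gfu'.
apply: etrans (jacobian_comp df dg).
have nfu : \near u, rep_dom setT f i j u.
  by apply: near_open => //; have [] := sf i j.
apply/esym/near_eq_jacobian; first exact: differentiable_comp.
by apply: filterS nfu => v [_ [_ jfv]]; rewrite /= (rep_comp g k jfv).
Qed.

(** A vector killed by the Jacobian would have length 0 in the metric of [S]; being an immersion
    thus follows from preserving the metric. *)
Lemma preserves_metric_row_free S M (f : S -> M) (i : idx S) (j : idx M) u :
  riemannian_manifold S -> preserves_metric f -> rep_dom setT f i j u ->
  row_free (jacobian (rep f i j) u).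
Proof.
move=> [_ _ _ pos _] pf fu; have [iu _] := fu.
apply: inj_row_free => h hJ; apply/eqP; apply: contraT => h0.
have := pos i u iu h h0.
by rewrite (pf i j u fu) !mulmxA hJ !mul0mx mxE ltxx.
Qed.

(** A tangent vector is a family over all charts, so a vector [v0] given in one chart is spread to
    the others by the Jacobians of the transition maps. The chain rule gives the transformation laws
    at [p] and at [f p]. *)
Lemma tangent_image_lift S M (f : S -> M) (p : S) (i : idx S) (j : idx M) v0 :
  smooth_manifold S -> smooth_manifold M -> msmooth_on setT f ->
  patch i p -> patch j (f p) ->
  exists2 w, tangent_image f p w &
    w j = v0 *m jacobian (rep f i j) (coord i p).
Proof.
move=> mS mM sf ip jfp.
have sS : msmooth_on setT (@id S) by case: mS.
have sM : msmooth_on setT (@id M) by case: mM.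
pose v k := if `[< patch k p >]
  then v0 *m jacobian (rep (@id S) i k) (coord i p) else 0.
pose w l := if `[< patch l (f p) >]
  then v0 *m jacobian (rep f i l) (coord i p) else 0.
have vE k : patch k p -> v k = v0 *m jacobian (rep (@id S) i k) (coord i p).
  by move=> kp; rewrite /v; case: asboolP.
have wE l : patch l (f p) -> w l = v0 *m jacobian (rep f i l) (coord i p).
  by move=> lp; rewrite /w; case: asboolP.
exists w; last exact: wE.
split; first split.
- by move=> l nl; rewrite /w; case: asboolP.
- move=> l l' lp l'p; rewrite (wE _ lp) (wE _ l'p) -mulmxA; apply: (congr1 (mulmx v0)).
  have -> : coord l (f p) = rep f i l (coord i p) by rewrite /rep /= par_coord.
  apply: (@jacobian_rep_comp S M M f id) => //; first exact: rep_dom_coord.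
  by rewrite par_coord.
- exists v; first split.
  + by move=> k nk; rewrite /v; case: asboolP.
  + move=> k k' kp k'p; rewrite (vE _ kp) (vE _ k'p) -mulmxA.
    apply: (congr1 (mulmx v0)).
    have -> : coord k p = rep id i k (coord i p) by rewrite /rep /= par_coord.
    apply: (@jacobian_rep_comp S S S id id) => //; first exact: rep_dom_coord.
    by rewrite par_coord.
  + move=> k l kp lp; rewrite (wE _ lp) (vE _ kp) -mulmxA; apply: (congr1 (mulmx v0)).
    have -> : coord k p = rep id i k (coord i p) by rewrite /rep /= par_coord.
    apply: (@jacobian_rep_comp S S M id f) => //; first exact: rep_dom_coord.
    by rewrite par_coord.
Qed.

(* The image is open since [j] is a local homeomorphism, and closed since it is
   compact. *)
Lemma compact_local_isometry_surj S M (j : S -> M) (p0 : S) :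
  smooth_manifold M -> connected [set: M] -> compact [set: S] ->
  local_isometry j -> forall y, exists x, j x = y.
Proof.
move=> mM cM cS [_ lj]; have hM : hausdorff_space M by case: mM.
have cj : continuous j.
  move=> p; have [U [V [h [[oU oV Up] [sj _ _ _]]]]] := lj p.
  move=> W; rewrite /= nbhsE => -[W' [oW' W'jp] W'W].
  have : \near p, (U `&` j @^-1` W') p.
    by apply: near_open => //; exact: msmooth_on_continuous.
  by apply: filterS => x [_ /= /W'W].
have rT : range j = setT.
  apply: cM; first by exists (j p0), p0.
    exists (range j); last by rewrite setTI.
    apply: openP => _ [p _ <-].
    have [U [V [h [[oU oV Up] [_ _ UV VU]]]]] := lj p.
    have : \forall y \near j p, V y by apply: near_open => //; case: (UV p Up).
    by apply: filterS => y /VU[_ <-]; exists (h y).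
  exists (range j); last by rewrite setTI.
  apply: compact_closed => //; apply: continuous_compact => //.
  exact: continuous_subspaceT.
by move=> y; have : [set: M] y by []; rewrite -rT => -[x _ <-]; exists x.
Qed.

(** The global inverse is smooth because near each point it coincides with a local inverse: both are
    sections of the injective map [j]. *)
Lemma compact_local_isometry S M (j : S -> M) (p0 : S) :
  smooth_manifold M -> connected [set: M] -> compact [set: S] ->
  injective j -> local_isometry j -> isometry j.
Proof.
move=> mM cM cS ij lij.
have sj := compact_local_isometry_surj p0 mM cM cS lij.
have [pj lj] := lij.
pose h y := sval (cid (sj y)).
have hK : cancel h j by move=> y; rewrite /h; case: cid.
have jK : cancel j h by move=> x; apply: ij; rewrite hK.
exists h; split => //; apply: msmooth_on_local => p.
  by have [U [V [g [[oU oV Up] [sU _ _ _]]]]] := lj p; exists U.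
have [U [V [g [[oU oV Up] [_ sV UV VU]]]]] := lj (h p).
exists V; first by have [] := UV _ Up; rewrite hK.
by apply: msmooth_on_congr sV => y /VU[_ {2}<-]; rewrite jK.
Qed.

End charts.

(** * Central projections *)

Section gnomonic_projection.
Context {R : realType}.

Definition dot n (x y : 'rV[R]_n) : R := \sum_i x 0 i * y 0 i.

Lemma dotE n (x y : 'rV[R]_n) : dot x y = (x *m y^T) 0 0.
Proof. by rewrite mxE; apply: eq_bigr => i _; rewrite mxE. Qed.

Lemma mulmx_tr_dot n (x y : 'rV[R]_n) : x *m y^T = (dot x y)%:M.
Proof. by rewrite dotE; apply/matrixP => i j; rewrite !ord1 [RHS]mxE. Qed.

Lemma dotC n (x y : 'rV[R]_n) : dot x y = dot y x.
Proof. by apply: eq_bigr => i _; rewrite mulrC. Qed.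

Lemma dotZl n a (x y : 'rV[R]_n) : dot (a *: x) y = a * dot x y.
Proof. by rewrite mulr_sumr; apply: eq_bigr => i _; rewrite mxE mulrA. Qed.

Lemma dotZr n a (x y : 'rV[R]_n) : dot x (a *: y) = a * dot x y.
Proof. by rewrite dotC dotZl dotC. Qed.

Lemma dotDl n (x y z : 'rV[R]_n) : dot (x + y) z = dot x z + dot y z.
Proof. by rewrite -big_split; apply: eq_bigr => i _; rewrite mxE mulrDl. Qed.

Lemma dotDr n (x y z : 'rV[R]_n) : dot z (x + y) = dot z x + dot z y.
Proof. by rewrite dotC dotDl !(dotC z). Qed.

Lemma dotNl n (x y : 'rV[R]_n) : dot (- x) y = - dot x y.
Proof. by rewrite -scaleN1r dotZl mulN1r. Qed.

Lemma dotNr n (x y : 'rV[R]_n) : dot x (- y) = - dot x y.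
Proof. by rewrite dotC dotNl dotC. Qed.

Lemma dotxx n (x : 'rV[R]_n) : dot x x = sqnorm x.
Proof. by apply: eq_bigr => i _; rewrite expr2. Qed.

Lemma dot_mul n p (L : 'M[R]_(n, p)) (x y : 'rV[R]_n) :
  L *m L^T = 1%:M -> dot (x *m L) (y *m L) = dot x y.
Proof. by move=> LL; rewrite !dotE trmx_mul mulmxA -(mulmxA x) LL mulmx1. Qed.

Lemma sqnorm_mul n p (L : 'M[R]_(n, p)) (x : 'rV[R]_n) :
  L *m L^T = 1%:M -> sqnorm (x *m L) = sqnorm x.
Proof. by move=> LL; rewrite -!dotxx dot_mul. Qed.

Lemma sqnormD n (x y : 'rV[R]_n) :
  sqnorm (x + y) = sqnorm x + 2 * dot x y + sqnorm y.
Proof. by rewrite -!dotxx !dotDl !dotDr (dotC y x); ring. Qed.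

Lemma sqnorm_eq0 n (x : 'rV[R]_n) : (sqnorm x == 0) = (x == 0).
Proof.
rewrite psumr_eq0 => [|i _]; last exact: sqr_ge0.
apply/allP/idP => [x0|/eqP-> i _]; last by rewrite mxE expr0n eqxx.
apply/eqP.
apply/rowP => i; rewrite mxE; apply/eqP; rewrite -sqrf_eq0.
by have := x0 i; rewrite mem_index_enum => /(_ isT).
Qed.

(* Homogeneous coordinates [1 : u], and back. *)
Definition homog n (u : 'rV[R]_n) : 'rV[R]_n.+1 := row_mx (1%:M : 'M[R]_1) u.

Definition dehomog n (z : 'rV[R]_n.+1) : 'rV[R]_n :=
  \row_i (z 0 (lift ord0 i) / z 0 0).

Lemma homog0 n (u : 'rV[R]_n) : homog u 0 0 = 1.
Proof. by rewrite mxE; case: splitP => [j _|//]; rewrite ord1 mxE eqxx. Qed.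

Lemma homogS n (u : 'rV[R]_n) i : homog u 0 (lift ord0 i) = u 0 i.
Proof.
rewrite mxE; case: splitP => [j|j /=]; first by rewrite ord1.
by move=> [ij]; congr (u _ _); exact/val_inj.
Qed.

Lemma homogK n : cancel (@homog n) (@dehomog n).
Proof. by move=> u; apply/rowP => i; rewrite mxE homog0 homogS divr1. Qed.

Lemma rowSP n (x y : 'rV[R]_n.+1) :
  x 0 0 = y 0 0 -> (forall i, x 0 (lift ord0 i) = y 0 (lift ord0 i)) -> x = y.
Proof. by move=> xy0 xyS; apply/rowP => i; case: (unliftP ord0 i) => [j|] ->. Qed.

Lemma dehomogK n (z : 'rV[R]_n.+1) : z 0 0 != 0 ->
  z = z 0 0 *: homog (dehomog z).
Proof.
move=> z0; apply: rowSP => [|i]; first by rewrite mxE homog0 mulr1.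
by rewrite mxE homogS mxE mulrCA divff// mulr1.
Qed.

Lemma dehomogZ n a (z : 'rV[R]_n.+1) : a != 0 -> dehomog (a *: z) = dehomog z.
Proof. by move=> a0; apply/rowP => i; rewrite !mxE -mulf_div divff// mul1r. Qed.

Lemma dot_homog n (u v : 'rV[R]_n) : dot (homog u) (homog v) = 1 + dot u v.
Proof.
rewrite /dot big_ord_recl !homog0 mulr1; congr (_ + _).
by apply: eq_bigr => i _; rewrite !homogS.
Qed.

Lemma sqnorm_homog n (u : 'rV[R]_n) : sqnorm (homog u) = 1 + sqnorm u.
Proof. by rewrite -!dotxx dot_homog. Qed.

Lemma sqnorm_homog_gt0 n (u : 'rV[R]_n) : 0 < 1 + sqnorm u.
Proof. by rewrite ltr_pwDl// sqnorm_ge0. Qed.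

(** The factor that brings [homog u] to length [r]. *)
Definition gscale n (r : R) (u : 'rV[R]_n) : R := r / Num.sqrt (1 + sqnorm u).

Lemma gscale_gt0 n (r : R) (u : 'rV[R]_n) : 0 < r -> 0 < gscale r u.
Proof. by move=> r0; rewrite divr_gt0// sqrtr_gt0 sqnorm_homog_gt0. Qed.

Lemma gscale_sqr n (r : R) (u : 'rV[R]_n) : gscale r u ^+ 2 = r ^+ 2 / (1 + sqnorm u).
Proof. by rewrite exprMn exprVn sqr_sqrtr// ltW// sqnorm_homog_gt0. Qed.

Section frame.
Context {n : nat} {r : R} (r0 : 0 < r) {B : 'M[R]_n.+1} (BB : B *m B^T = 1%:M).

Lemma gnomonicE u : gnomonic r B u = gscale r u *: (homog u *m B).
Proof. by []. Qed.

Lemma gnomonic_mul_tr u : gnomonic r B u *m B^T = gscale r u *: homog u.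
Proof. by rewrite gnomonicE -scalemxAl -mulmxA BB mulmx1. Qed.

Lemma gnomonicK u : dehomog (gnomonic r B u *m B^T) = u.
Proof. by rewrite gnomonic_mul_tr dehomogZ ?homogK// gt_eqF// gscale_gt0. Qed.

Lemma gnomonic_cap u : 0 < (gnomonic r B u *m B^T) 0 0.
Proof. by rewrite gnomonic_mul_tr mxE homog0 mulr1 gscale_gt0. Qed.

Lemma sqnorm_gnomonic u : sqnorm (gnomonic r B u) = r ^+ 2.
Proof.
rewrite gnomonicE sqnormZ sqnorm_mul// sqnorm_homog gscale_sqr divfK//.
by rewrite gt_eqF// sqnorm_homog_gt0.
Qed.

(** Dehomogenizing forgets a factor, the height of [z] over the frame; as it is positive,
    normalizing to length [r] recovers the direction of [z] and not its opposite. *)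
Lemma gnomonic_dehomog (z : 'rV[R]_n.+1) : 0 < (z *m B^T) 0 0 ->
  gnomonic r B (dehomog (z *m B^T)) = (r / Num.sqrt (sqnorm z)) *: z.
Proof.
set y := z *m B^T => y0.
have yE := dehomogK (lt0r_neq0 y0).
have BtB : B^T *m B = 1%:M by exact: mulmx1C.
have zy : z = y *m B by rewrite /y -mulmxA BtB mulmx1.
have -> : sqnorm z = y 0 0 ^+ 2 * (1 + sqnorm (dehomog y)).
  by rewrite zy sqnorm_mul// {1}yE sqnormZ sqnorm_homog.
rewrite sqrtrM ?sqr_ge0// sqrtr_sqr gtr0_norm// gnomonicE.
have zE : z = y 0 0 *: (homog (dehomog y) *m B).
  by rewrite [LHS]zy {1}yE -scalemxAl.
rewrite [X in _ = _ *: X]zE scalerA.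
congr (_ *: _).
by rewrite /gscale invfM mulrAC -!mulrA mulVKf ?gt_eqF// mulrC.
Qed.

End frame.

Lemma differentiable_mx (V : normedModType R) m n (f : V -> 'M[R]_(m, n)) x :
  (forall i j, differentiable (fun x => f x i j) x) -> differentiable f x.
Proof.
move=> df; rewrite (_ : f =
    \sum_i \sum_j (fun x => f x i j *: (delta_mx i j : 'M[R]_(m, n)))).
  apply: differentiable_sum => i; apply: differentiable_sum => j.
  exact: differentiableZl.
apply/funext => y; rewrite [LHS]matrix_sum_delta fct_sumE.
by apply: eq_bigr => i _; rewrite fct_sumE.
Qed.

Lemma is_derive_coord n (u h : 'rV[R]_n) i :
  is_derive u h (fun v : 'rV[R]_n => v 0 i : R) (h 0 i).
Proof.
apply: DeriveDef; first exact: diff_derivable (differentiable_coord _ _ _).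
have /(congr1 (fun M : 'rV[R]_n => M 0 i)) := derive_id u h.
by rewrite derive_mx ?mxE// => /esym.
Qed.

Lemma is_derive_sqnorm n (u h : 'rV[R]_n) :
  is_derive u h (@sqnorm R n) (2 * dot u h).
Proof.
have dc i := is_derive_coord u h i.
rewrite (_ : @sqnorm R n = \sum_i (fun v : 'rV[R]_n => v 0 i) ^+ 2); last first.
  by apply/funext => v; rewrite fct_sumE.
apply: is_derive_eq; rewrite mulr_sumr; apply: eq_bigr => i _.
by rewrite /GRing.scale /= expr1; ring.
Qed.

Lemma differentiable_sqnorm n (u : 'rV[R]_n) : differentiable (@sqnorm R n) u.
Proof.
rewrite (_ : @sqnorm R n = \sum_i (fun v : 'rV[R]_n => v 0 i) ^+ 2); last first.
  by apply/funext => v; rewrite fct_sumE.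
apply: differentiable_sum => i; apply: differentiableX.
exact: differentiable_coord.
Qed.

Lemma differentiable_gscale n (r : R) (u : 'rV[R]_n) : differentiable (gscale r) u.
Proof.
have u0 := sqnorm_homog_gt0 u.
have dn : differentiable (fun v : 'rV[R]_n => 1 + sqnorm v) u.
  by apply: differentiableD => //; exact: differentiable_sqnorm.
apply: (@differentiableM _ _ (cst r) (fun v => (Num.sqrt (1 + sqnorm v))^-1)).
  exact: differentiable_cst.
apply: differentiableV; last by rewrite gt_eqF// sqrtr_gt0.
apply: (@differentiable_comp _ _ _ _ (fun v : 'rV[R]_n => 1 + sqnorm v)) => //.
by apply/derivable1_diffP; have [] := is_derive1_sqrt u0.
Qed.

(* Differentiating [gscale r u ^+ 2 = r ^+ 2 / (1 + sqnorm u)]. *)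
Lemma derive_gscale n (r : R) (u h : 'rV[R]_n) : 0 < r ->
  'D_h (gscale r) u = - (gscale r u * dot u h / (1 + sqnorm u)).
Proof.
move=> r0; have u0 := sqnorm_homog_gt0 u; have g0 := gscale_gt0 u r0.
have dg : derivable (gscale r) u h.
  exact: diff_derivable (differentiable_gscale _ _).
have ds := is_derive_sqnorm u h.
have e : (fun v : 'rV[R]_n => gscale r v * gscale r v * (1 + sqnorm v)) =
    cst (r ^+ 2).
  apply/funext => v; rewrite -expr2 gscale_sqr divfK// gt_eqF//.
  exact: sqnorm_homog_gt0.
have : is_derive u h (gscale r * gscale r * (cst 1 + @sqnorm R n))
    (gscale r u * gscale r u * (2 * dot u h) +
     (1 + sqnorm u) * (2 * gscale r u * 'D_h (gscale r) u)).
  have := derivableP dg => dg'; apply: is_derive_eq.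
  by rewrite /GRing.scale /= !fctE; ring.
rewrite (_ : _ * _ = cst (r ^+ 2))// => -[_]; rewrite derive_cst => /esym.
move=> /eqP; rewrite (_ : _ + _ = 2 * gscale r u *
  (gscale r u * dot u h + (1 + sqnorm u) * 'D_h (gscale r) u)); last by ring.
have g2 : 2 * gscale r u != 0 by rewrite gt_eqF// mulr_gt0.
rewrite mulf_eq0 (negbTE g2) addr_eq0 => /eqP e'.
by rewrite e' mulNr opprK mulrAC divff ?mul1r// gt_eqF.
Qed.

End gnomonic_projection.

(** * The round metric in central projection coordinates *)

Section gnomonic_metric.
Context {R : realType}.

Lemma gnomonic_differentiable n (r : R) (B : 'M[R]_n.+1) (u : 'rV[R]_n) :
  differentiable (gnomonic r B) u.
Proof.
have dh : differentiable (fun v => gscale r v *: homog v) u.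
  apply: differentiable_mx => i j; rewrite ord1.
  rewrite (_ : (fun _ => _) = gscale r * (fun v => homog v 0 j)); last first.
    by apply/funext => v; rewrite mxE.
  apply: differentiableM; first exact: differentiable_gscale.
  case: (unliftP ord0 j) => [k|] ->.
    rewrite (_ : (fun _ => _) = (fun v : 'rV[R]_n => v 0 k)).
      exact: differentiable_coord.
    by apply/funext => v; rewrite homogS.
  rewrite (_ : (fun _ => _) = cst 1); first exact: differentiable_cst.
  by apply/funext => v; rewrite homog0.
rewrite (_ : gnomonic r B = (fun w : 'rV[R]_n.+1 => w *m B) \o
    (fun v => gscale r v *: homog v)).
  by apply: differentiable_comp dh _; exact: differentiable_mulmxr.
by apply/funext => v /=; rewrite -scalemxAl.
Qed.

(* The vector [0 : h], a point of the hyperplane at infinity. *)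
Definition atinf n (h : 'rV[R]_n) : 'rV[R]_n.+1 := row_mx (0 : 'M[R]_1) h.

Lemma atinf0 n (h : 'rV[R]_n) : atinf h 0 0 = 0.
Proof. by rewrite mxE; case: splitP => [j _|//]; rewrite mxE. Qed.

Lemma atinfS n (h : 'rV[R]_n) i : atinf h 0 (lift ord0 i) = h 0 i.
Proof.
rewrite mxE; case: splitP => [j|j /=]; first by rewrite ord1.
by move=> [ij]; congr (h _ _); exact/val_inj.
Qed.

Lemma dot_atinf n (h k : 'rV[R]_n) : dot (atinf h) (atinf k) = dot h k.
Proof.
rewrite /dot big_ord_recl !atinf0 mulr0 add0r.
by apply: eq_bigr => i _; rewrite !atinfS.
Qed.

Lemma dot_atinf_homog n (h u : 'rV[R]_n) : dot (atinf h) (homog u) = dot h u.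
Proof.
rewrite /dot big_ord_recl atinf0 mul0r add0r.
by apply: eq_bigr => i _; rewrite atinfS homogS.
Qed.

(** Up to the scale, the image of [h] is the component of [atinf h] orthogonal to [homog u]: tangent
    vectors of the sphere are orthogonal to the position, and [dot (atinf h) (homog u)] is
    [dot h u]. *)
Lemma jacobian_gnomonic n (r : R) (B : 'M[R]_n.+1) (u h : 'rV[R]_n) : 0 < r ->
  h *m jacobian (gnomonic r B) u =
  gscale r u *: ((atinf h - (dot u h / (1 + sqnorm u)) *: homog u) *m B).
Proof.
move=> r0.
have dg := gnomonic_differentiable r (1%:M : 'M[R]_n.+1) u.
have dgs : derivable (gscale r) u h.
  exact: diff_derivable (differentiable_gscale _ _).
have -> : jacobian (gnomonic r B) u = jacobian (gnomonic r 1%:M) u *m B.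
  have -> : gnomonic r B = (fun v => gnomonic r 1%:M v *m B).
    by apply/funext => v; rewrite !gnomonicE mulmx1 -scalemxAl.
  exact: jacobian_mulmxr.
rewrite mulmxA scalemxAl; congr (_ *m B).
rewrite -deriveEjacobian// derive_mx; last exact: diff_derivable.
have E (a b : R) (x y : 'rV[R]_n.+1) i :
    (a *: (x - b *: y)) 0 i = a * (x 0 i - b * y 0 i) by rewrite !mxE.
apply: rowSP => [|i]; rewrite E [LHS]mxE.
  rewrite (_ : (fun _ => _) = gscale r); last first.
    by apply/funext => v; rewrite gnomonicE mulmx1 mxE homog0 mulr1.
  by rewrite derive_gscale// atinf0 homog0 mulr1 sub0r mulrN mulrA.
rewrite (_ : (fun _ => _) = gscale r * (fun v : 'rV[R]_n => v 0 i)); last first.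
  by apply/funext => v; rewrite gnomonicE mulmx1 mxE homogS.
have dc := is_derive_coord u h i.
rewrite deriveM//.
rewrite (@derive_val _ _ _ _ _ _ _ dc) derive_gscale// atinfS homogS.
by rewrite /GRing.scale /=; ring.
Qed.

Lemma dot_jacobian_gnomonic n (r : R) (B : 'M[R]_n.+1) (u h k : 'rV[R]_n) :
  0 < r -> B *m B^T = 1%:M ->
  dot (h *m jacobian (gnomonic r B) u) (k *m jacobian (gnomonic r B) u) =
  r ^+ 2 / (1 + sqnorm u) *
    (dot h k - dot u h * dot u k / (1 + sqnorm u)).
Proof.
move=> r0 BB; have u0 := lt0r_neq0 (sqnorm_homog_gt0 u).
rewrite !jacobian_gnomonic// dotZl dotZr mulrA -expr2 gscale_sqr; congr (_ * _).
rewrite dot_mul// !dotDl !dotDr !dotNl !dotNr !dotZl !dotZr dot_atinf.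
rewrite (dotC (homog u)) !dot_atinf_homog dotxx sqnorm_homog !(dotC _ u).
by field.
Qed.

(* The round metric of radius [r] in central projection coordinates. *)
Definition gmetric n (r : R) (u : 'rV[R]_n) : 'M[R]_n :=
  (r ^+ 2 / (1 + sqnorm u)) *: (1%:M - (1 + sqnorm u)^-1 *: (u^T *m u)).

Lemma gmetricE n (r : R) (u : 'rV[R]_n) a b :
  gmetric r u a b = r ^+ 2 / (1 + sqnorm u) *
    ((a == b)%:R - u 0 a * u 0 b / (1 + sqnorm u)).
Proof.
rewrite !mxE big_ord1 !mxE; congr (_ * (_ - _)); exact: mulrC.
Qed.

Lemma dot_delta n (x : 'rV[R]_n) a : dot x (delta_mx 0 a) = x 0 a.
Proof.
rewrite /dot (bigD1 a)//= mxE !eqxx mulr1 big1 ?addr0// => i /negbTE ia.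
by rewrite mxE ia andbF mulr0.
Qed.

Lemma gmetric_jacobian n (r : R) (B : 'M[R]_n.+1) (u : 'rV[R]_n) :
  0 < r -> B *m B^T = 1%:M ->
  let J := jacobian (gnomonic r B) u in J *m J^T = gmetric r u.
Proof.
move=> r0 BB J; apply/matrixP => a b; rewrite gmetricE.
have -> : (J *m J^T) a b = dot (delta_mx 0 a *m J) (delta_mx 0 b *m J).
  by rewrite -!rowE mxE; apply: eq_bigr => i _; rewrite !mxE.
rewrite dot_jacobian_gnomonic// !dot_delta; congr (_ * (_ - _)).
by rewrite mxE eqxx eq_sym.
Qed.

Lemma gmetric_sym n (r : R) (u : 'rV[R]_n) : (gmetric r u)^T = gmetric r u.
Proof.
by apply/matrixP => a b; rewrite mxE !gmetricE eq_sym (mulrC (u 0 b)).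
Qed.

Lemma gmetric_form n (r : R) (u h k : 'rV[R]_n) :
  (h *m gmetric r u *m k^T) 0 0 =
  r ^+ 2 / (1 + sqnorm u) * (dot h k - dot u h * dot u k / (1 + sqnorm u)).
Proof.
rewrite /gmetric -scalemxAr -scalemxAl mxE; congr (_ * _).
rewrite mulmxBr mulmx1 mulmxBl mxE -dotE; congr (_ + _).
rewrite mxE -scalemxAr -scalemxAl mxE [h *m (_ *m _)]mulmxA.
rewrite -[_ *m u *m _]mulmxA !mulmx_tr_dot -scalar_mxM mxE eqxx (dotC h).
by rewrite mulr1n mulrC.
Qed.

Lemma gmetric_gt0 n (r : R) (u h : 'rV[R]_n) : 0 < r -> h != 0 ->
  0 < (h *m gmetric r u *m h^T) 0 0.
Proof.
move=> r0 h0; have u0 := sqnorm_homog_gt0 u.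
have h0' : 0 < sqnorm h by rewrite lt0r sqnorm_eq0 h0 sqnorm_ge0.
rewrite gmetric_form mulr_gt0// ?divr_gt0 ?exprn_gt0//.
(* Lagrange's identity [|h|^2 |u|^2 - <u,h>^2 >= 0], from
   [| |h|^2 u - <u,h> h |^2 >= 0] *)
have := sqnorm_ge0 (sqnorm h *: u + (- dot u h) *: h).
rewrite sqnormD !sqnormZ dotZl dotZr => L.
have L' : 0 <= sqnorm h * (sqnorm h * sqnorm u - dot u h ^+ 2).
  by apply: le_trans L _; rewrite le_eqVlt; apply/orP; left; apply/eqP; ring.
move: L'; rewrite pmulr_rge0// => L'.
rewrite subr_gt0 ltr_pdivrMr// dotxx; nra.
Qed.

Lemma gmetric_unit n (r : R) (u : 'rV[R]_n) : 0 < r -> gmetric r u \in unitmx.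
Proof.
move=> r0; rewrite -row_free_unit; apply: inj_row_free => h hg.
apply/eqP; apply: contraT => h0.
by have := gmetric_gt0 u r0 h0; rewrite hg mul0mx mxE ltxx.
Qed.

Lemma is_derive_gmetric n (r : R) (u h : 'rV[R]_n) a b :
  is_derive u h (fun v => gmetric r v a b)
   (r ^+ 2 * ((- 2 * dot u h * (a == b)%:R - h 0 a * u 0 b - u 0 a * h 0 b)
      / (1 + sqnorm u) ^+ 2 + 4 * u 0 a * u 0 b * dot u h / (1 + sqnorm u) ^+ 3)).
Proof.
have u0 := lt0r_neq0 (sqnorm_homog_gt0 u).
pose s : 'rV[R]_n -> R := cst 1 + @sqnorm R n.
have ds : is_derive u h s (2 * dot u h).
  have dn := is_derive_sqnorm u h.
  by apply: is_derive_eq; rewrite add0r.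
have dV : is_derive u h (fun v => (s v)^-1) (- (s u) ^- 2 * (2 * dot u h)).
  have ds' : derivable s u h by case: ds.
  apply: DeriveDef; first exact: derivableV.
  by rewrite deriveV// (@derive_val _ _ _ _ _ _ _ ds).
have da := is_derive_coord u h a; have db := is_derive_coord u h b.
(* Written with the ring operations on functions, so that the [is_derive] instances compute the
   derivative. *)
rewrite (_ : (fun v => _) = cst (r ^+ 2) * (fun v => (s v)^-1) *
    (cst (a == b)%:R - (fun v : 'rV[R]_n => v 0 a) * (fun v : 'rV[R]_n => v 0 b) *
      (fun v => (s v)^-1))); last first.
  by apply/funext => v; rewrite gmetricE.
apply: is_derive_eq; rewrite /GRing.scale /= !fctE /s /= !fctE.
by field.
Qed.

End gnomonic_metric.

(** * Frames centred at a point, and smoothness in homogeneous coordinates *)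

Section sphere_quotients.
Context {R : realType}.

Lemma unit_frame n (x : 'rV[R]_n.+1) : sqnorm x = 1 ->
  exists B : orthogonal_frame n.+1, delta_mx 0 0 *m sval B = x.
Proof.
move=> x1; pose e0 : 'rV[R]_n.+1 := delta_mx 0 0.
(* In this case the vector [w] of the reflection used below vanishes. *)
have [xe|xe] := eqVneq x e0.
  have I1 : (1%:M : 'M[R]_n.+1) *m 1%:M^T == 1%:M by rewrite trmx1 mulmx1.
  by exists (exist _ 1%:M I1); rewrite /= mulmx1.
(* the reflection exchanging [e0] and [x] *)
pose w := e0 - x; pose H := 1%:M - (2 / sqnorm w) *: (w^T *m w).
have e01 : sqnorm e0 = 1 by rewrite -dotxx dot_delta mxE eqxx.
have w0 : sqnorm w != 0 by rewrite sqnorm_eq0 subr_eq0 eq_sym.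
have wE : sqnorm w = 2 * dot e0 w.
  by rewrite -!dotxx /w !(dotDl, dotDr, dotNl, dotNr) (dotC x e0) !dotxx x1 e01; ring.
have HT : H^T = H by rewrite /H linearB /= linearZ /= trmx_mul trmxK trmx1.
have HH : H *m H^T == 1%:M.
  apply/eqP; rewrite HT {2}/H mulmxBr mulmx1 /H mulmxBl mul1mx.
  rewrite -!scalemxAr -!scalemxAl scalerA mulmxA -(mulmxA w^T) mulmx_tr_dot.
  rewrite dotxx mul_mx_scalar -scalemxAl scalerA.
  have -> : 2 / sqnorm w * (2 / sqnorm w) * sqnorm w = 2 / sqnorm w *+ 2.
    by rewrite mulr2n; field.
  by rewrite -scalerMnl mulr2n opprB addrK subrK.
exists (exist _ H HH); rewrite /= -/e0 /H mulmxBr mulmx1 -scalemxAr mulmxA.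
rewrite mulmx_tr_dot mul_scalar_mx scalerA [X in _ - X *: _](_ : _ = 1).
  by rewrite scale1r /w opprB addrC subrK.
by rewrite wE; field; move: w0; rewrite wE mulf_eq0 negb_or => /andP[].
Qed.

Lemma homog_zero n : homog (0 : 'rV[R]_n) = delta_mx 0 0.
Proof.
apply: rowSP => [|i]; first by rewrite homog0 mxE eqxx.
by rewrite homogS !mxE.
Qed.

Lemma sqnorm0 n : sqnorm (0 : 'rV[R]_n) = 0.
Proof. by apply/eqP; rewrite sqnorm_eq0. Qed.

Lemma gnomonic0 n (r : R) (B : 'M[R]_n.+1) :
  gnomonic r B 0 = r *: (delta_mx 0 0 *m B).
Proof. by rewrite gnomonicE homog_zero /gscale sqnorm0 addr0 sqrtr1 divr1. Qed.

Lemma frame_at n (r : R) (x : 'rV[R]_n.+1) : 0 < r -> sqnorm x = r ^+ 2 ->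
  exists B : orthogonal_frame n.+1, gnomonic r (sval B) 0 = x.
Proof.
move=> r0 xr; have [|B BE] := @unit_frame n (r^-1 *: x).
  by rewrite sqnormZ xr exprVn mulVf// expf_neq0// gt_eqF.
by exists B; rewrite gnomonic0 BE scalerA divff ?scale1r// gt_eqF.
Qed.

(** The domain [V] is left general to cover both transition maps, where [c] is the identity, and
    curves in a chart. *)
Lemma smooth_on_homog_mul (V : normedModType R) m n (A : set V)
    (c : V -> 'rV[R]_m) (L : 'M[R]_(m.+1, n)) :
  open A -> smooth_on A c -> smooth_on A (fun t => homog (c t) *m L).
Proof.
move=> oA sc k; apply: Ck_mx => // i j; rewrite ord1.
apply: (@Ck_congr _ _ _ _ _ (fun t => \sum_l homog (c t) 0 l * L l j)) => //.
  by move=> t _; rewrite [RHS]mxE.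
apply: Ck_sum => // l; apply: CkM => //; last exact: Ck_cst.
case: (unliftP ord0 l) => [l'|] ->.
  apply: (@Ck_congr _ _ _ _ _ (fun t => c t 0 l')) => //.
    by move=> t _; rewrite homogS.
  exact: Ck_comp_coord.
by apply: (Ck_congr oA _ (Ck_cst k A (1 : R))) => t _; rewrite homog0.
Qed.

Lemma smooth_on_dehomog (V : normedModType R) m n (A : set V)
    (c : V -> 'rV[R]_m) (L : 'M[R]_(m.+1, n.+1)) :
  open A -> (forall t, A t -> (homog (c t) *m L) 0 0 != 0) ->
  smooth_on A c -> smooth_on A (fun t => dehomog (homog (c t) *m L)).
Proof.
move=> oA L0 sc k; have sL := smooth_on_homog_mul L oA sc.
apply: Ck_mx => // i j; rewrite ord1.
apply: (@Ck_congr _ _ _ _ _ (fun t => (homog (c t) *m L) 0 (lift ord0 j) *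
  ((homog (c t) *m L) 0 0)^-1)) => //; first by move=> t _; rewrite [RHS]mxE.
apply: CkM => //; first exact: Ck_comp_coord (sL k).
by apply: CkV => //; exact: Ck_comp_coord (sL k).
Qed.

Lemma smooth_on_id n (A : set 'rV[R]_n) : open A -> smooth_on A id.
Proof. by move=> oA k; apply: Ck_mx => // i j; exact: Ck_coord. Qed.

Lemma smooth_on_gmetric n (r : R) (A : set 'rV[R]_n) :
  open A -> smooth_on A (gmetric r).
Proof.
move=> oA k; have sN : Ck k A (fun u : 'rV[R]_n => (1 + sqnorm u)^-1).
  apply: CkV => // [u _|]; first by rewrite gt_eqF// sqnorm_homog_gt0.
  apply: CkD => //; first exact: Ck_cst.
  apply: Ck_sum => // i; apply: (@Ck_congr _ _ _ _ _
    (fun u : 'rV[R]_n => u 0 i * u 0 i)) => //.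
  by apply: CkM => //; exact: Ck_coord.
apply: Ck_mx => // a b.
apply: (@Ck_congr _ _ _ _ _ (fun u : 'rV[R]_n =>
    r ^+ 2 * (1 + sqnorm u)^-1 * ((a == b)%:R +
    (-1) * ((u 0 a * u 0 b) * (1 + sqnorm u)^-1)))) => //.
  by move=> u _; rewrite gmetricE mulN1r.
apply: CkM => //; first by apply: CkM => //; exact: Ck_cst.
apply: CkD => //; first exact: Ck_cst.
apply: CkM => //; first exact: Ck_cst.
by apply: CkM => //; apply: CkM => //; exact: Ck_coord.
Qed.

Lemma continuous_mulmxr n p (L : 'M[R]_(n, p)) :
  continuous (fun u : 'rV[R]_n => u *m L).
Proof.
by move=> u; apply: differentiable_continuous; exact: differentiable_mulmxr.
Qed.

Lemma continuous_dehomog n (z : 'rV[R]_n.+1) : z 0 0 != 0 ->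
  {for z, continuous (@dehomog R n)}.
Proof.
move=> z0; apply: differentiable_continuous; apply: differentiable_mx => i j.
rewrite ord1 (_ : (fun _ => _) = (fun y : 'rV[R]_n.+1 => y 0 (lift ord0 j)) *
  (fun y : 'rV[R]_n.+1 => (y 0 0)^-1)); last by apply/funext => y; rewrite mxE.
apply: differentiableM; first exact: differentiable_coord.
by apply: differentiableV => //; exact: differentiable_coord.
Qed.

End sphere_quotients.

(** * Quotients of spheres *)

Section finite_quotients.
Context {R : realType}.

(* By the last condition the non-trivial transformations move every point by at
   least a right angle, so that the classes meet the spherical caps covered by
   the charts in at most one point. *)
Definition isometric_quotient n (r : R) (e : equiv_rel (sphere n r))
    (Gam : seq 'M[R]_n.+1) : Prop :=
  [/\ forall x y, e x y = has (fun G => val y == val x *m G) Gam,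
      {in Gam, forall G, G *m G^T = 1%:M}
    & {in Gam, forall G, G = 1%:M \/ forall x, dot x (x *m G) <= 0}].

Definition sphere_pt n (r : R) (z : 'rV[R]_n.+1) (zr : sqnorm z == r ^+ 2) :
  sphere n r := exist (fun z : 'rV[R]_n.+1 => is_true (sqnorm z == r ^+ 2)) z zr.

Lemma id_frame_subproof n : (1%:M : 'M[R]_n) *m 1%:M^T == 1%:M.
Proof. by rewrite trmx1 mulmx1. Qed.

Definition id_frame n : orthogonal_frame n :=
  exist (fun B : 'M[R]_n => is_true (B *m B^T == 1%:M)) 1%:M
    (id_frame_subproof n).

Definition qproj n (r : R) (e : equiv_rel (sphere n r)) (x : sphere n r) :
    sphere_quotient e := \pi_{eq_quot e} x.

(** Follows from [|u + v|^2 >= 0]. Geometrically, two points of the same cap make an acute angle. *)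
Lemma dot_unit_ball n (u v : 'rV[R]_n) :
  sqnorm u < 1 -> sqnorm v < 1 -> 0 < 1 + dot u v.
Proof.
have := sqnorm_ge0 (u + v); rewrite sqnormD.
move: (sqnorm u) (sqnorm v) (dot u v) => a b c; lra.
Qed.

Section quotient.
Context {n : nat} {r : R} (r0 : 0 < r) {e : equiv_rel (sphere n r)}.
Context {Gam : seq 'M[R]_n.+1} (eG : isometric_quotient e Gam).
Local Notation M := (sphere_quotient e).
Implicit Types (x y : sphere n r) (B C : @orthogonal_frame R n.+1).

Lemma frameE B : sval B *m (sval B)^T = 1%:M.
Proof. by case: B => B /= /eqP. Qed.

Lemma qproj_eqP x y :
  qproj e x = qproj e y <-> exists2 G, G \in Gam & val y = val x *m G.
Proof.
have [eE _ _] := eG; rewrite /qproj; split.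
  by move=> /eqmodP; rewrite eE => /hasP[G GG /eqP]; exists G.
by move=> [G GG yE]; apply/eqmodP; rewrite eE; apply/hasP; exists G => //; apply/eqP.
Qed.

Lemma qproj_surj (p : M) : exists x, p = qproj e x.
Proof. by exists (repr (p : {eq_quot e})); rewrite /qproj reprK. Qed.

Lemma sphereE x : sqnorm (val x) = r ^+ 2.
Proof. by case: x => x /= /eqP. Qed.

Lemma Gam_orth G : G \in Gam -> G *m G^T = 1%:M.
Proof. by case: eG => _ + _; exact. Qed.

Lemma par_qproj B u : par (m := M) B u = qproj e (gnomonic_pt r B u).
Proof. by []. Qed.

(** Two points [x] and [x G] of one cap have a positive scalar product, which [disc] excludes unless
    [G = 1]. *)
Lemma par_inj B : {in dom (m := M) B &, injective (par (m := M) B)}.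
Proof.
move=> u v /set_mem u1 /set_mem v1; rewrite !par_qproj => /qproj_eqP[G GG].
rewrite /= => vuG; have [_ _ disc] := eG.
have BB := frameE B.
case: (disc G GG) => [G1|/(_ (gnomonic r (sval B) u))].
  by rewrite -(gnomonicK r0 BB u) -(gnomonicK r0 BB v) vuG G1 mulmx1.
rewrite -vuG !gnomonicE dotZl dotZr mulrA dot_mul// dot_homog.
have g0 : 0 < gscale r u * gscale r v by apply: mulr_gt0; exact: gscale_gt0.
rewrite (pmulr_rle0 _ g0) => uv.
by have := dot_unit_ball u1 v1; rewrite ltNge uv.
Qed.

Lemma coord_qproj B u : sqnorm u < 1 ->
  coord (M := M) B (par (m := M) B u) = u.
Proof. by move=> u1; rewrite /coord pinvKV ?inE//; exact: par_inj. Qed.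

Lemma patch_qproj B x : patch (M := M) B (qproj e x) <->
  exists G, [/\ G \in Gam, 0 < (val x *m G *m (sval B)^T) 0 0
    & sqnorm (dehomog (val x *m G *m (sval B)^T)) < 1].
Proof.
have BB := frameE B; split.
  move=> [u u1]; rewrite par_qproj => /esym/qproj_eqP[G GG /= uE].
  by exists G; rewrite -uE gnomonicK// gnomonic_cap.
move=> [G [GG z0 z1]]; exists (dehomog (val x *m G *m (sval B)^T)) => //.
rewrite par_qproj; apply/esym/qproj_eqP; exists G => //=.
rewrite gnomonic_dehomog// sqnorm_mul ?Gam_orth// sphereE sqrtr_sqr.
by rewrite gtr0_norm// divff ?gt_eqF// scale1r.
Qed.

Lemma frame_patch x : exists B, gnomonic r (sval B) 0 = val x /\
  par (m := M) B 0 = qproj e x.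
Proof.
have [B BE] := frame_at r0 (sphereE x); exists B; split => //.
by rewrite par_qproj; congr qproj; exact/val_inj.
Qed.

Lemma patch_cover (p : M) : exists B, patch (M := M) B p.
Proof.
have [x ->] := qproj_surj p; have [B [_ <-]] := frame_patch x.
by exists B; exists 0 => //=; rewrite sqnorm0.
Qed.

Lemma metric_gmetric B u : metric (m := M) B u = gmetric r u.
Proof. exact: gmetric_jacobian (frameE B). Qed.

Lemma metric_ext B : metric (m := M) B = gmetric r.
Proof. by apply/funext => u; exact: metric_gmetric. Qed.

Lemma qproj_open (O : set 'rV[R]_n.+1) : open O ->
  open [set p : M | exists2 x, O (val x) & p = qproj e x].
Proof.
move=> oO; suff: atlas_open [set p : M | exists2 x, O (val x) & p = qproj e x].
  by [].
move=> B; apply: openP => u [u1 [x Ox]]; rewrite par_qproj => /qproj_eqP[G GG xE].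
(* The matrix [G] found at [u] is kept for all nearby [v]. *)
have cg : {for u, continuous (fun v => gnomonic r (sval B) v *m G)}.
  apply: differentiable_continuous.
  apply: (@differentiable_comp _ _ _ _ _ (fun w : 'rV[R]_n.+1 => w *m G)).
    exact: gnomonic_differentiable.
  exact: differentiable_mulmxr.
have nO : \forall w \near gnomonic r (sval B) u *m G, O w.
  by apply: near_open => //; rewrite -[gnomonic _ _ _]/(val (gnomonic_pt r B u)) -xE.
have n1 : \near u, dom (m := M) B u by apply: near_open => //; exact: dom_open.
apply: filterS2 n1 (cg _ nO) => v v1 Ov; split => //.
have vr : sqnorm (gnomonic r (sval B) v *m G) == r ^+ 2.
  by rewrite sqnorm_mul ?Gam_orth// sqnorm_gnomonic// frameE.
exists (sphere_pt vr) => //.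
by rewrite par_qproj; apply/qproj_eqP; exists G.
Qed.

Definition normalize (z : 'rV[R]_n.+1) : 'rV[R]_n.+1 :=
  (r / Num.sqrt (sqnorm z)) *: z.

Lemma normalize_sphere z : z != 0 -> sqnorm (normalize z) == r ^+ 2.
Proof.
move=> z0; have z1 : 0 < sqnorm z by rewrite lt0r sqnorm_eq0 z0 sqnorm_ge0.
rewrite sqnormZ exprMn exprVn sqr_sqrtr ?ltW// divfK// gt_eqF//.
Qed.

(* The class of the radial projection of [z], and a junk value at [z = 0]. *)
Definition qnorm (z : 'rV[R]_n.+1) : M :=
  if pselect (sqnorm (normalize z) == r ^+ 2) is left zr
  then qproj e (sphere_pt zr)
  else qproj e (gnomonic_pt r (id_frame n.+1) 0).

Lemma qnorm_sphere x : qnorm (val x) = qproj e x.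
Proof.
have nx : normalize (val x) = val x.
  rewrite /normalize sphereE sqrtr_sqr gtr0_norm// divff ?gt_eqF// scale1r//.
rewrite /qnorm; case: pselect => [xr|]; first by congr qproj; exact/val_inj.
by rewrite nx sphereE eqxx.
Qed.

Lemma qnorm_par B z : 0 < (z *m (sval B)^T) 0 0 ->
  qnorm z = par (m := M) B (dehomog (z *m (sval B)^T)).
Proof.
move=> z0; have BB := frameE B.
have zn : z != 0 by apply: contraTneq z0 => ->; rewrite mul0mx mxE ltxx.
rewrite /qnorm; case: pselect => [zr|]; last by rewrite normalize_sphere.
by rewrite par_qproj; congr qproj; apply/val_inj; rewrite /= gnomonic_dehomog.
Qed.

(** In the frame centred at the radial projection of [z], the height of [z] is positive and its
    coordinates are 0. By [qnorm_par], near [z] the map is the parametrization composed with a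
    continuous map. *)
Lemma qnorm_continuous (z : 'rV[R]_n.+1) : z != 0 -> {for z, continuous qnorm}.
Proof.
move=> z0; have /eqP zr := normalize_sphere z0.
have [B BE] := frame_at r0 zr; have BB := frameE B.
have z1 : 0 < sqnorm z by rewrite lt0r sqnorm_eq0 z0 sqnorm_ge0.
have c0 : 0 < Num.sqrt (sqnorm z) / r by rewrite divr_gt0// sqrtr_gt0.
have zE : z = (Num.sqrt (sqnorm z) / r) *: gnomonic r (sval B) 0.
  have s0 : Num.sqrt (sqnorm z) != 0 by rewrite gt_eqF// sqrtr_gt0.
  have rn0 := lt0r_neq0 r0.
  rewrite BE /normalize scalerA [X in X *: _](_ : _ = 1) ?scale1r//.
  by field; rewrite s0 rn0.
have zB : 0 < (z *m (sval B)^T) 0 0.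
  by rewrite zE -scalemxAl mxE mulr_gt0// gnomonic_cap.
have uB : dehomog (z *m (sval B)^T) = 0.
  by rewrite zE -scalemxAl dehomogZ ?gt_eqF// gnomonicK.
have cB : {for z, continuous (fun w : 'rV[R]_n.+1 => w *m (sval B)^T)}.
  exact: continuous_mulmxr.
have cu : {for z, continuous (fun w : 'rV[R]_n.+1 => dehomog (w *m (sval B)^T))}.
  by apply: continuous_comp cB _; apply: continuous_dehomog; rewrite gt_eqF.
move=> W Wz.
have [W' [oW' W'z] W'W] : exists2 W', open_nbhs (qnorm z) W' & W' `<=` W.
  by move: Wz; rewrite nbhsE.
have nB : \near z, 0 < (z *m (sval B)^T) 0 0.
  have cz : {for z, continuous (fun w : 'rV[R]_n.+1 => (w *m (sval B)^T) 0 0)}.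
    by apply: (@continuous_comp _ _ _ _ (fun w : 'rV[R]_n.+1 => w 0 0) _ cB);
      exact: coord_continuous.
  have n0 : \forall t \near (z *m (sval B)^T) 0 0, 0 < t.
    exact: (near_open (@open_gt R 0) zB).
  exact: (cz _ n0).
have nW : \forall v \near dehomog (z *m (sval B)^T),
    (dom (m := M) B `&` par (m := M) B @^-1` W') v.
  apply: near_open; first exact: oW'.
  split; first by rewrite uB /= sqnorm0.
  suff: W' (par (m := M) B (dehomog (z *m (sval B)^T))) by [].
  by rewrite -qnorm_par.
suff: \forall w \near z, W (qnorm w) by [].
apply: filterS2 nB (cu _ nW) => w w0 [_ W'w].
by apply: W'W; rewrite (qnorm_par w0).
Qed.

(** The image under [qnorm] of the sphere, which is closed in the compact cube with sides
    [[-r, r]]. *)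
Lemma quotient_compact : compact [set: M].
Proof.
pose K := [set z : 'rV[R]_n.+1 | sqnorm z = r ^+ 2].
have K0 z : K z -> z != 0.
  move=> Kz; apply/eqP => z0; have := lt0r_neq0 (exprn_gt0 2 r0).
  by rewrite -Kz z0 sqnorm0 eqxx.
have -> : [set: M] = qnorm @` K.
  apply/seteqP; split => // p _; have [x ->] := qproj_surj p.
  by exists (val x); [exact: sphereE|exact: qnorm_sphere].
apply: continuous_compact.
  apply: continuous_in_subspaceT => z; rewrite inE => /K0; exact: qnorm_continuous.
pose Q := [set z : 'rV[R]_n.+1 | forall i, `[- r, r]%classic (z ord0 i)].
apply: (@subclosed_compact _ K Q).
- rewrite (_ : K = (@sqnorm R n.+1) @^-1` [set r ^+ 2])//.
  apply: closed_comp => [z _|]; first exact: sqnorm_continuous.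
  exact: closed_eq.
- apply: (@rV_compact R n.+1 (fun=> `[- r, r]%classic)) => i.
  exact: segment_compact.
- move=> z Kz i /=; rewrite in_itv /= -ler_norml -(@ler_pXn2r _ 2) ?nnegrE ?(ltW r0)//.
  rewrite real_normK ?num_real// -Kz /sqnorm (bigD1 i)//= lerDl.
  by apply: sumr_ge0 => j _; rewrite sqr_ge0.
Qed.

Lemma seq_lower_bound_gt0 (T : Type) (s : seq T) (g : T -> R) :
  (forall t, 0 < g t) -> exists2 d, 0 < d & all (fun t => d < g t) s.
Proof.
move=> g0; elim: s => [|t s [d d0 ds]]; first by exists 1.
exists (Num.min d (g t / 2)); first by rewrite lt_min d0 divr_gt0.
rewrite /= gt_min; apply/andP; split.
  by rewrite ltr_pdivrMr// ltr_pMr// ltr1n orbT.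
by apply: sub_all ds => t' dt'; rewrite gt_min dt'.
Qed.

(** Take [d] below the squared distance from [x] to every translate of [y]. The points closer than
    [d] to [x] and the points all of whose translates are farther than [d] from [x] have disjoint
    images. *)
Lemma quotient_hausdorff : hausdorff_space M.
Proof.
rewrite open_hausdorff => p q; have [x ->] := qproj_surj p.
have [y ->] := qproj_surj q => xy.
(* The bound [seq_lower_bound_gt0] wants positivity for every matrix, so the value 0, impossible for
   [G] in [Gam], is replaced by 1. *)
pose g (t : R) := if t == 0 then 1 else t.
have g0 G : 0 < g (sqnorm (val x - val y *m G)).
  rewrite /g; case: eqVneq => [_|]; first exact: ltr01.
  by rewrite lt0r sqnorm_ge0 andbT.
have [d d0 /allP dG] := seq_lower_bound_gt0 Gam g0.
have {}dG G : G \in Gam -> d < sqnorm (val x - val y *m G).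
  move=> GG; have := dG G GG; rewrite /g; case: eqVneq => // /eqP.
  rewrite sqnorm_eq0 subr_eq0 => /eqP xyG; case/eqP: xy; apply/esym/qproj_eqP.
  by exists G.
pose cG G := fun z : 'rV[R]_n.+1 => sqnorm (val x - z *m G).
have cont G : continuous (cG G).
  move=> z; have c1 : {for z, continuous (fun z : 'rV[R]_n.+1 => val x - z *m G)}.
    by apply: continuousB; [exact: cst_continuous|exact: continuous_mulmxr].
  exact: (continuous_comp c1 (@sqnorm_continuous R n.+1 _)).
pose U := [set z | cG 1%:M z < d].
pose V (s : seq 'M[R]_n.+1) := [set z : 'rV[R]_n.+1 | {in s, forall G, d < cG G z}].
have oU : open U.
  rewrite (_ : U = cG 1%:M @^-1` [set t | t < d])//.
  by apply: open_comp => [z _|]; [exact: cont|exact: open_lt].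
have oV s : open (V s).
  elim: s => [|G s IH]; first by rewrite (_ : V [::] = setT)//;
    [exact: openT|exact/seteqP].
  rewrite (_ : V _ = cG G @^-1` [set t | d < t] `&` V s); last first.
    apply/seteqP; split=> z => [Vz|[Gz Vz] H]; last first.
      by rewrite inE => /predU1P[->|]; [exact: Gz|exact: Vz].
    split; first by apply: Vz; rewrite inE eqxx.
    by move=> H Hs; apply: Vz; rewrite inE Hs orbT.
  by apply: openI => //; apply: open_comp => [z _|]; [exact: cont|exact: open_gt].
exists ([set p : M | exists2 x, U (val x) & p = qproj e x],
        [set p : M | exists2 x, V Gam (val x) & p = qproj e x]) => /=.
  split; rewrite inE /=.
    by exists x => //; rewrite /U /= /cG mulmx1 subrr sqnorm0.
  by exists y => // G GG; exact: dG.
split; [exact: qproj_open|exact: qproj_open|].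
apply/eqP/seteqP; split => // p' [[z Uz ->] [w Vw]] /esym/qproj_eqP[G GG zE].
have wz : cG G (sval w) = cG 1%:M (sval z).
  by rewrite /cG mulmx1; congr (sqnorm (_ - _)); exact/esym.
by move: (Vw G GG); rewrite wz => dz; have := lt_trans dz Uz; rewrite ltxx.
Qed.

(* Images of the balls with rational centres and radii [1 / k.+1]. *)
Lemma quotient_second_countable : @second_countable M.
Proof.
pose b (a : 'rV[rat]_n.+1 * nat) : set 'rV[R]_n.+1 :=
  [set z | forall i, `|z 0 i - ratr (a.1 0 i)| < a.2.+1%:R^-1].
pose B a : set M := [set p : M | exists2 x, b a (val x) & p = qproj e x].
have ob a : open (b a).
  apply: openP => z bz.
  suff: \forall w \near z, forall i,
      `|(w : 'rV[R]_n.+1) 0 i - ratr (a.1 0 i)| < a.2.+1%:R^-1.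
    by [].
  apply: (@filter_forall _ _ (fun i (w : 'rV[R]_n.+1) =>
    `|w 0 i - ratr (a.1 0 i)| < a.2.+1%:R^-1) _ (nbhs_filter z)) => i.
  have cz : {for z, continuous (fun w : 'rV[R]_n.+1 => `|w 0 i - ratr (a.1 0 i)|)}.
    have c1 : {for z, continuous (fun w : 'rV[R]_n.+1 => w 0 i - ratr (a.1 0 i))}.
      by apply: continuousB; [exact: coord_continuous|exact: cst_continuous].
    exact: (continuous_comp c1 (@norm_continuous _ _ _)).
  exact: (cz _ (near_open (@open_lt R _) (bz i))).
exists (range B); first by apply: (@sub_countable _ _ _ [set: 'rV[rat]_n.+1 * nat]);
  [exact: card_image_le|exact: countableP].
split; first by move=> _ [a _ <-]; exact: qproj_open.
move=> p W Wp; have [x pE] := qproj_surj p.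
have x0 : val x != 0.
  apply: contraTneq (exprn_gt0 2 r0) => x0.
  by rewrite -(sphereE x) x0 sqnorm0 ltxx.
(* [W] is pulled back to the ambient space, where the balls of the sup norm are boxes. *)
have /(qnorm_continuous x0) : nbhs (qnorm (val x)) W.
  by rewrite qnorm_sphere -pE.
move=> /nbhs_ballP[d /= d0 dW].
(* Half of [d], because [x] and [y] are compared through the rational centre [q]. *)
have [k kd] : exists k : nat, k.+1%:R^-1 < d / 2.
  have [k] := ltr_add_invr (divr_gt0 d0 (ltr0n _ 2)); rewrite add0r => ?; by exists k.
have k0 : 0 < k.+1%:R^-1 :> R by rewrite invr_gt0 ltr0n.
have qx i : exists q : rat, `|val x 0 i - ratr q| < k.+1%:R^-1.
  have [|q] := @rat_in_itvoo R (val x 0 i - k.+1%:R^-1) (val x 0 i + k.+1%:R^-1).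
    by rewrite ltrD2l gt0_cp.
  by rewrite in_itv /= -ltr_distl distrC => ?; exists q.
pose q : 'rV[rat]_n.+1 := \row_i sval (cid (qx i)).
have bx : b (q, k) (val x) by move=> i /=; rewrite mxE; case: cid.
exists (B (q, k)); first by split; [exists (q, k)|exists x].
move=> _ [y by_ ->]; rewrite -qnorm_sphere; apply: dW; split => // i j.
rewrite ord1 /ball /=.
have -> : val x 0 j - val y 0 j =
  (val x 0 j - ratr (q 0 j)) - (val y 0 j - ratr (q 0 j)) by ring.
rewrite (le_lt_trans (ler_normB _ _))// (splitr d).
by rewrite ltrD// (lt_trans _ kd).
Qed.

End quotient.
End finite_quotients.

(** * Maps induced by isometric linear embeddings *)

Section induced_maps.
Context {R : realType}.

Section map.
Context {m n : nat} {r : R} (r0 : 0 < r).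
Context {e1 : equiv_rel (sphere m r)} {e2 : equiv_rel (sphere n r)}.
Context {G2 : seq 'M[R]_n.+1} (q2 : isometric_quotient e2 G2).
Local Notation S := (sphere_quotient e1).
Local Notation M := (sphere_quotient e2).
Context {E : 'M[R]_(m.+1, n.+1)} (EE : E *m E^T = 1%:M).
Context {f : S -> M}.
Hypothesis fE : forall (x : sphere m r) (y : sphere n r),
  val y = val x *m E -> f (qproj e1 x) = qproj e2 y.
Implicit Types (B : @orthogonal_frame R m.+1) (C : @orthogonal_frame R n.+1).

(** The lift [x |-> x E G], read in the frames [B] and [C]. *)
Definition lift_mx B (G : 'M[R]_n.+1) C : 'M[R]_(m.+1, n.+1) :=
  sval B *m E *m G *m (sval C)^T.

Definition chart_map B G C (u : 'rV[R]_m) : 'rV[R]_n :=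
  dehomog (homog u *m lift_mx B G C).

Definition chart_dom B G C : set 'rV[R]_m :=
  [set u | [/\ sqnorm u < 1, 0 < (homog u *m lift_mx B G C) 0 0
     & sqnorm (chart_map B G C u) < 1]].

Lemma lift_mx_orth B G C : G \in G2 ->
  lift_mx B G C *m (lift_mx B G C)^T = 1%:M.
Proof.
move=> GG; have CC := mulmx1C (frameE C).
rewrite /lift_mx !trmx_mul trmxK !mulmxA -(mulmxA _ (sval C)^T) CC mulmx1.
by rewrite -(mulmxA _ G) (Gam_orth q2 GG) mulmx1 -(mulmxA _ E) EE mulmx1 frameE.
Qed.

Lemma gnomonic_chart_map B G C u : G \in G2 -> 
  0 < (homog u *m lift_mx B G C) 0 0 ->
  gnomonic r (sval C) (chart_map B G C u) =
  gnomonic r (sval B) u *m E *m G.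
Proof.
move=> GG u0; have zE : homog u *m lift_mx B G C =
    homog u *m sval B *m E *m G *m (sval C)^T by rewrite /lift_mx !mulmxA.
rewrite /chart_map zE gnomonic_dehomog ?frameE//; last by rewrite -zE.
rewrite sqnorm_mul ?(Gam_orth q2 GG)// sqnorm_mul// sqnorm_mul ?frameE//.
by rewrite sqnorm_homog gnomonicE /gscale -!scalemxAl.
Qed.

Lemma sphere_E (x : sphere m r) : sqnorm (val x *m E) == r ^+ 2.
Proof. by rewrite sqnorm_mul// sphereE. Qed.

Lemma f_qproj x : f (qproj e1 x) = qproj e2 (sphere_pt (sphere_E x)).
Proof. exact: fE. Qed.

Lemma f_par B G C u : G \in G2 -> 0 < (homog u *m lift_mx B G C) 0 0 ->
  f (par (m := S) B u) = par (m := M) C (chart_map B G C u).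
Proof.
move=> GG u0; rewrite !par_qproj f_qproj; apply/(qproj_eqP q2); exists G => //=.
exact: gnomonic_chart_map.
Qed.

Lemma chart_dom_open B G C : open (chart_dom B G C).
Proof.
pose A := [set u | 0 < (homog u *m lift_mx B G C) 0 0].
have oT : open [set: 'rV[R]_m] by exact: openT.
have oA : open A.
  apply: openP => u Au.
  have sA := smooth_on_homog_mul (lift_mx B G C) oT (smooth_on_id oT).
  have cA := smooth_on_continuous sA (I : [set: 'rV[R]_m] u).
  have c0 := continuous_comp cA (@coord_continuous _ _ _ 0 0 _).
  exact: (c0 _ (near_open (@open_gt R 0) Au)).
apply: openP => u [u1 u0 u2].
have sC : smooth_on A (chart_map B G C).
  by apply: smooth_on_dehomog => // [v|]; [exact: lt0r_neq0|exact: smooth_on_id].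
have cC := smooth_on_continuous sC u0.
have n2 : \near u, sqnorm (chart_map B G C u) < 1.
  have c2 := continuous_comp cC (@sqnorm_continuous _ _ _).
  exact: (c2 _ (near_open (@open_lt R 1) u2)).
have n1 : \near u, sqnorm u < 1 by exact: (near_open (@open_unit_ball R m)).
have n0 : \near u, A u by exact: near_open.
by apply: filterS3 n0 n1 n2.
Qed.

Lemma smooth_chart_map B G C : smooth_on (chart_dom B G C) (chart_map B G C).
Proof.
apply: smooth_on_dehomog; first exact: chart_dom_open.
  by move=> u [_ u0 _]; exact: lt0r_neq0.
by apply: smooth_on_id; exact: chart_dom_open.
Qed.

(** The branches exhaust the domain: if the class of the image lies in the patch of [C], some
    representative [x E G] lies in its cap. The factor [gscale r u] affects neither the sign of the
    height nor the quotient of coordinates. *)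
Lemma rep_domP B C u : rep_dom setT f B C u <->
  exists2 G, G \in G2 & chart_dom B G C u.
Proof.
split=> [[u1 [_ /=]]|[G GG [u1 u0 u2]]].
  rewrite /preimage /= -[\pi _]/(qproj e1 (gnomonic_pt r B u)) f_qproj.
  move=> /(patch_qproj r0 q2)[G [GG z0 z2]]; exists G => //.
  have zE : val (sphere_pt (sphere_E (gnomonic_pt r B u))) *m G *m (sval C)^T =
      gscale r u *: (homog u *m lift_mx B G C).
    by rewrite /lift_mx /= gnomonicE -!scalemxAl !mulmxA.
  move: z0 z2; rewrite zE dehomogZ ?gt_eqF ?gscale_gt0// mxE pmulr_rgt0//.
  exact: gscale_gt0.
split=> //; split=> //; rewrite /preimage.
suff: patch (M := M) C (f (par (m := S) B u)) by [].
by rewrite (f_par GG u0); exists (chart_map B G C u).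
Qed.

Lemma rep_chart_map B G C u : G \in G2 -> chart_dom B G C u ->
  rep f B C u = chart_map B G C u.
Proof.
move=> GG [u1 u0 u2]; rewrite /rep /comp (f_par GG u0).
exact: (coord_qproj r0 q2).
Qed.

Lemma rep_near B G C u : G \in G2 -> chart_dom B G C u ->
  \forall v \near u, chart_map B G C v = rep f B C v.
Proof.
move=> GG Du; have : \near u, chart_dom B G C u.
  by apply: near_open => //; exact: chart_dom_open.
by apply: filterS => v Dv; rewrite (rep_chart_map GG Dv).
Qed.

Lemma induced_msmooth : msmooth_on setT f.
Proof.
move=> B C; have oD : open (rep_dom setT f B C).
  apply: openP => u /rep_domP[G GG Du].
  have : \near u, chart_dom B G C u.
    by apply: near_open => //; exact: chart_dom_open.
  by apply: filterS => v Dv; apply/rep_domP; exists G.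
split => //; apply: smooth_on_local => u /rep_domP[G GG Du].
exists (chart_dom B G C) => //.
apply: smooth_on_congr (@smooth_chart_map B G C); first exact: chart_dom_open.
by move=> v Dv; rewrite (rep_chart_map GG Dv).
Qed.

(** Differentiates the identity of [gnomonic_chart_map], which holds on the whole open set
    [chart_dom B G C]. *)
Lemma jacobian_induced B G C u : G \in G2 -> chart_dom B G C u ->
  jacobian (rep f B C) u *m jacobian (gnomonic r (sval C)) (rep f B C u) =
  jacobian (gnomonic r (sval B)) u *m E *m G.
Proof.
move=> GG Du; have dT := smooth_on_differentiable (@smooth_chart_map B G C) Du.
have nT := rep_near GG Du.
have dR := near_eq_differentiable nT dT.
apply: etrans (esym (jacobian_comp dR (gnomonic_differentiable _ _ _))) _.
have dB := gnomonic_differentiable r (sval B) u.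
have dBE : differentiable (fun v => gnomonic r (sval B) v *m E) u.
  apply: (@differentiable_comp _ _ _ _ _ (fun w : 'rV[R]_m.+1 => w *m E)) => //.
  exact: differentiable_mulmxr.
apply: etrans (_ : jacobian (fun v => gnomonic r (sval B) v *m E *m G) u = _).
  apply/esym/near_eq_jacobian.
    apply: (@differentiable_comp _ _ _ _ _ (fun w : 'rV[R]_n.+1 => w *m G)) => //.
    exact: differentiable_mulmxr.
  have : \near u, chart_dom B G C u.
    by apply: near_open => //; exact: chart_dom_open.
  apply: filterS => v Dv; rewrite /= (rep_chart_map GG Dv).
  by have [_ v0 _] := Dv; rewrite gnomonic_chart_map.
by rewrite (jacobian_mulmxr G dBE) (jacobian_mulmxr E dB).
Qed.

(** The metrics are Gram matrices of ambient differentials, related by [jacobian_induced]; [E] and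
    [G] cancel against their transposes. *)
Lemma induced_preserves_metric : preserves_metric f.
Proof.
move=> B C u /rep_domP[G GG Du] J.
rewrite /metric /= mulmxA -mulmxA -trmx_mul (jacobian_induced GG Du).
rewrite !trmx_mul !mulmxA -(mulmxA _ G) (Gam_orth q2 GG) mulmx1.
by rewrite -(mulmxA _ E) EE mulmx1.
Qed.

End map.

Section manifold.
Context {n : nat} {r : R} (r0 : 0 < r) {e : equiv_rel (sphere n r)}.
Context {Gam : seq 'M[R]_n.+1} (q : isometric_quotient e Gam).
Local Notation M := (sphere_quotient e).

Lemma id_induced (x y : sphere n r) :
  val y = val x *m 1%:M -> @id M (qproj e x) = qproj e y.
Proof. by rewrite mulmx1 => yx; congr qproj; exact/val_inj. Qed.

Lemma mul1_tr1 k : (1%:M : 'M[R]_k) *m 1%:M^T = 1%:M.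
Proof. by rewrite trmx1 mulmx1. Qed.

Lemma sphere_quotient_smooth : smooth_manifold M.
Proof.
split.
- exact: (par_inj r0 q).
- exact: (patch_cover r0).
- exact: (induced_msmooth r0 q (mul1_tr1 _) (@id_induced)).
- exact: (quotient_hausdorff q).
- exact: (quotient_second_countable r0 q).
Qed.

Lemma sphere_quotient_riemannian : riemannian_manifold M.
Proof.
split; first exact: sphere_quotient_smooth.
- move=> B; rewrite metric_ext//; apply: smooth_on_gmetric; exact: dom_open.
- by move=> B u _; rewrite metric_gmetric// gmetric_sym.
- by move=> B u _ h h0; rewrite metric_gmetric// gmetric_gt0.
- exact: (induced_preserves_metric r0 q (mul1_tr1 _) (@id_induced)).
Qed.

End manifold.

End induced_maps.

(** * Geodesics *)

Section geodesics.
Context {R : realType}.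

Lemma sum_mul_delta n (F : 'I_n -> R) b : \sum_i F i * (i == b)%:R = F b.
Proof.
rewrite (bigD1 b)//= eqxx mulr1 big1 ?addr0// => i /negbTE ->.
by rewrite mulr0.
Qed.

(* The Christoffel symbols of a projectively flat metric: the geodesics are the
   straight lines, not affinely parametrized. *)
Lemma christoffel_sphere_quotient n (r : R) (e : equiv_rel (sphere n r))
    (B : @orthogonal_frame R n.+1) (u : 'rV[R]_n) (k a b : 'I_n) : 0 < r ->
  christoffel (M := sphere_quotient e) B u k a b =
  - (u 0 a * (k == b)%:R + u 0 b * (k == a)%:R) / (1 + sqnorm u).
Proof.
move=> r0; have u0 := lt0r_neq0 (sqnorm_homog_gt0 u).
have pE (x y z : 'I_n) : partial (M := sphere_quotient e) B x y z u =
    r ^+ 2 * ((- 2 * u 0 x * (y == z)%:R - (y == x)%:R * u 0 z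
      - u 0 y * (z == x)%:R) / (1 + sqnorm u) ^+ 2 +
      4 * u 0 y * u 0 z * u 0 x / (1 + sqnorm u) ^+ 3).
  rewrite /partial metric_ext//.
  have dg := is_derive_gmetric r u (delta_mx 0 x) y z.
  by rewrite (@derive_val _ _ _ _ _ _ _ dg) dot_delta !mxE !eqxx.
(* Twice the expected symbol. Rather than inverting [gmetric], one checks that [gmetric] sends [y]
   to the combination of partial derivatives. *)
pose y m : R := - 2 / (1 + sqnorm u) *
  (u 0 a * (m == b)%:R + u 0 b * (m == a)%:R).
have XE l : partial (M := sphere_quotient e) B a b l u +
    partial (M := sphere_quotient e) B b a l u -
    partial (M := sphere_quotient e) B l a b u =
    \sum_m gmetric r u l m * y m.
  transitivity (- 2 / (1 + sqnorm u) *
      (u 0 a * gmetric r u l b + u 0 b * gmetric r u l a)).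
    rewrite !pE !gmetricE (eq_sym b a) (eq_sym l b) (eq_sym l a); by field.
  rewrite -(sum_mul_delta (gmetric r u l) b) -(sum_mul_delta (gmetric r u l) a).
  rewrite !mulr_sumr -big_split mulr_sumr; apply: eq_bigr => m _.
  by rewrite /y /=; ring.
rewrite /christoffel metric_ext//.
under eq_bigr do rewrite XE.
have -> : \sum_l invmx (gmetric r u) k l * (\sum_m gmetric r u l m * y m) = y k.
  have := mulKmx (gmetric_unit u r0) (\col_m y m).
  move=> /matrixP/(_ k 0); rewrite !mxE => <-.
  apply: eq_bigr => l _; rewrite !mxE; congr (_ * _).
  by apply: eq_bigr => m _; rewrite !mxE.
by rewrite /y; field.
Qed.

Lemma christoffel_form n (r : R) (e : equiv_rel (sphere n r))
    (B : @orthogonal_frame R n.+1) (u v : 'rV[R]_n) (k : 'I_n) : 0 < r ->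
  \sum_a \sum_b christoffel (M := sphere_quotient e) B u k a b * v 0 a * v 0 b =
  - (2 * dot u v / (1 + sqnorm u) * v 0 k).
Proof.
move=> r0; pose s := 1 + sqnorm u.
transitivity (- s^-1 * (\sum_a \sum_b (u 0 a * v 0 a) * (v 0 b * (b == k)%:R) +
    \sum_a \sum_b (v 0 a * (a == k)%:R) * (u 0 b * v 0 b))).
  rewrite -big_split mulr_sumr; apply: eq_bigr => a _.
  rewrite -big_split mulr_sumr; apply: eq_bigr => b _ /=.
  rewrite christoffel_sphere_quotient// (eq_sym k) (eq_sym k) -/s.
  by ring.
under eq_bigr do rewrite -mulr_sumr sum_mul_delta.
rewrite -mulr_suml -/(dot u v).
under [X in _ * (_ + X)]eq_bigr do rewrite -mulr_sumr.
rewrite -mulr_suml sum_mul_delta -/(dot u v) /s; ring.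
Qed.

(** * Derivatives of smooth curves, entry by entry *)

Section smooth_curves.
Context {W : set R^o} (oW : open W).

Lemma near_in (P : R -> Prop) {t : R} (Wt : W t) :
  (forall s, W s -> P s) -> \forall s \near t, P s.
Proof. by move=> WP; have : \near t, W t by [apply: near_open]; exact: filterS. Qed.

Lemma near_eq_derive1 (V : normedModType R) (f g : R -> V) t :
  (\forall s \near t, f s = g s) -> derive1 f t = derive1 g t.
Proof. by move=> fg; rewrite !derive1E; exact: near_eq_derive. Qed.

Lemma smooth_on_derive1 (V : normedModType R) (c : R^o -> V) :
  smooth_on W c -> smooth_on W (derive1 c : R^o -> V).
Proof.
move=> sc k; have [_ /(_ 1)] := sc k.+1.
by congr Ck; apply/funext => x; rewrite derive1E.
Qed.

Lemma smooth_on_coord m n (c : R^o -> 'M[R]_(m, n)) i j :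
  smooth_on W c -> smooth_on W (fun s => c s i j : R).
Proof. by move=> sc k; exact: Ck_comp_coord (sc k). Qed.

Lemma smooth_on_is_derive (f : R^o -> R) {t : R} (Wt : W t) :
  smooth_on W f -> is_derive (t : R^o) 1 f (derive1 f t).
Proof.
move=> sf; apply: DeriveDef; last by rewrite derive1E.
exact: diff_derivable (smooth_on_differentiable sf Wt).
Qed.

Lemma derive1_coord {t : R} (Wt : W t) m n (c : R^o -> 'M[R]_(m, n)) i j :
  smooth_on W c -> derive1 c t i j = derive1 (fun s => c s i j) t.
Proof.
move=> sc; rewrite derive1E derive_mx ?mxE ?derive1E//.
exact: diff_derivable (smooth_on_differentiable sc Wt).
Qed.

Lemma derive1n2_coord {t : R} (Wt : W t) m n (c : R^o -> 'M[R]_(m, n)) i j :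
  smooth_on W c -> derive1n 2 c t i j = derive1n 2 (fun s => c s i j) t.
Proof.
move=> sc; rewrite /derive1n /= (derive1_coord Wt i j (smooth_on_derive1 sc)).
apply: near_eq_derive1; apply: (near_in Wt) => s Ws.
exact: (derive1_coord Ws i j sc).
Qed.

Lemma derive1M {t : R} (Wt : W t) (f g : R^o -> R) : smooth_on W f -> smooth_on W g ->
  derive1 (fun s => f s * g s) t = derive1 f t * g t + f t * derive1 g t.
Proof.
move=> sf sg; have df := smooth_on_is_derive Wt sf.
have dg := smooth_on_is_derive Wt sg.
have dfg : is_derive (t : R^o) 1 (f * g) (derive1 f t * g t + f t * derive1 g t).
  by apply: is_derive_eq; rewrite /GRing.scale /=; ring.
by rewrite derive1E; exact: (@derive_val _ _ _ _ _ _ _ dfg).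
Qed.

Lemma derive1D {t : R} (Wt : W t) (f g : R^o -> R) : smooth_on W f -> smooth_on W g ->
  derive1 (fun s => f s + g s) t = derive1 f t + derive1 g t.
Proof.
move=> sf sg; have df := smooth_on_is_derive Wt sf.
have dg := smooth_on_is_derive Wt sg.
have dfg : is_derive (t : R^o) 1 (f + g) (derive1 f t + derive1 g t).
  exact: is_derive_eq.
by rewrite derive1E; exact: (@derive_val _ _ _ _ _ _ _ dfg).
Qed.

Lemma derive1_lincomb {t : R} (Wt : W t) n (f : 'I_n -> R^o -> R)
    (l0 : R) (l : 'I_n -> R) :
  (forall i, smooth_on W (f i)) ->
  derive1 (fun s => l0 + \sum_i f i s * l i) t = \sum_i derive1 (f i) t * l i.
Proof.
move=> sf; have df i := smooth_on_is_derive Wt (sf i).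
have dF : is_derive (t : R^o) 1 (cst l0 + \sum_i (f i * cst (l i)))
    (\sum_i derive1 (f i) t * l i).
  apply: is_derive_eq; rewrite add0r; apply: eq_bigr => i _.
  by rewrite /GRing.scale /= !mulr0 add0r mulrC.
rewrite derive1E -(@derive_val _ _ _ _ _ _ _ dF); congr ('D_1 _ t).
by apply/funext => s; rewrite !fctE fct_sumE.
Qed.

Lemma derive1n2M {t : R} (Wt : W t) (f g : R^o -> R) : smooth_on W f -> smooth_on W g ->
  derive1n 2 (fun s => f s * g s) t =
  derive1n 2 f t * g t + 2 * (derive1 f t * derive1 g t) + f t * derive1n 2 g t.
Proof.
move=> sf sg; rewrite {1}/derive1n /=.
have sf' := smooth_on_derive1 sf; have sg' := smooth_on_derive1 sg.
have sM (h k : R^o -> R) : smooth_on W h -> smooth_on W k ->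
  smooth_on W (fun s => h s * k s) by move=> sh sk i; exact: CkM.
transitivity (derive1 (fun s => derive1 f s * g s + f s * derive1 g s) t).
  apply: near_eq_derive1; apply: (near_in Wt) => s Ws.
  exact: derive1M Ws _ _ sf sg.
rewrite (derive1D Wt (sM _ _ sf' sg) (sM _ _ sf sg')).
rewrite (derive1M Wt sf' sg) (derive1M Wt sf sg') /derive1n /=.
by rewrite mulr_natl mulr2n !addrA.
Qed.

Lemma derive1n2_lincomb {t : R} (Wt : W t) n (f : 'I_n -> R^o -> R)
    (l0 : R) (l : 'I_n -> R) :
  (forall i, smooth_on W (f i)) ->
  derive1n 2 (fun s => l0 + \sum_i f i s * l i) t =
  \sum_i derive1n 2 (f i) t * l i.
Proof.
move=> sf; rewrite {1}/derive1n /=.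
transitivity (derive1 (fun s => 0 + \sum_i derive1 (f i) s * l i) t).
  apply: near_eq_derive1; apply: (near_in Wt) => s Ws.
  by rewrite add0r; exact: derive1_lincomb Ws _ _ _ _ sf.
by rewrite (derive1_lincomb Wt) // => i; exact: smooth_on_derive1.
Qed.

End smooth_curves.

(* The geodesic equation in the coordinates of a central projection. *)
Definition projective_line n (c : R -> 'rV[R]_n) (t : R) : Prop :=
  forall k, derive1n 2 c t 0 k =
    2 * dot (c t) (derive1 c t) / (1 + sqnorm (c t)) * derive1 c t 0 k.

Lemma geodesic_eq n (r : R) (e : equiv_rel (sphere n r))
    (B : @orthogonal_frame R n.+1) (c : R -> 'rV[R]_n) (t : R) : 0 < r ->
  (forall k : 'I_n, derive1n 2 c t 0 k + \sum_a \sum_b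
      christoffel (M := sphere_quotient e) B (c t) k a b *
      derive1 c t 0 a * derive1 c t 0 b = 0) <-> projective_line c t.
Proof.
move=> r0; split=> H k; have := H k; rewrite christoffel_form//.
  by move=> /eqP; rewrite subr_eq0 => /eqP.
by move=> ->; rewrite subrr.
Qed.

(* With [X = (1, c)] the equation says [X'' = mu X'] where
   [mu = 2 <X, X'> / |X|^2]; it is preserved by linear isometries, and
   replacing [X] by [X / X_0] changes [mu] by [- 2 X_0' / X_0]. *)
Lemma projective_line_map m n (W : set R^o) (c : R -> 'rV[R]_m)
    (L : 'M[R]_(m.+1, n.+1)) (t : R) :
  open W -> W t -> smooth_on W (c : R^o -> 'rV[R]_m) -> L *m L^T = 1%:M ->
  (forall s, W s -> (homog (c s) *m L) 0 0 != 0) ->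
  projective_line c t ->
  projective_line (fun s => dehomog (homog (c s) *m L)) t.
Proof.
move=> oW Wt sc LL L0 Pc k.
pose Y l (s : R^o) : R := L 0 l + \sum_j c s 0 j * L (lift ord0 j) l.
have YE l s : (homog (c s) *m L) 0 l = Y l s.
  rewrite mxE big_ord_recl homog0 mul1r; congr (_ + _).
  by apply: eq_bigr => j _; rewrite homogS.
pose d (s : R^o) : 'rV[R]_n := dehomog (homog (c s) *m L).
have sd : smooth_on W d by exact: smooth_on_dehomog.
have scj j : smooth_on W (fun s : R^o => c s 0 j : R) by exact: smooth_on_coord.
have sdj j : smooth_on W (fun s : R^o => d s 0 j : R) by exact: smooth_on_coord.
have sY l : smooth_on W (Y l).
  move=> i; apply: CkD => //; first exact: Ck_cst.
  by apply: Ck_sum => // j; apply: CkM => //; [exact: scj|exact: Ck_cst].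
pose mu := 2 * dot (c t) (derive1 c t) / (1 + sqnorm (c t)).
(* The [Y l] are affine in [c], so they satisfy the same equation with the same [mu]. *)
have Y2 l : derive1n 2 (Y l) t = mu * derive1 (Y l) t.
  rewrite (derive1n2_lincomb oW Wt _ _ scj) (derive1_lincomb Wt _ _ scj).
  rewrite mulr_sumr; apply: eq_bigr => j _.
  rewrite -(derive1n2_coord oW Wt _ _ sc) -(derive1_coord Wt _ _ sc) (Pc j).
  by rewrite mulrA.
have aE (s : R) j : W s -> Y 0 s * d s 0 j = Y (lift ord0 j) s.
  by move=> Ws; rewrite /d mxE !YE mulrCA divff ?mulr1// -YE L0.
have a0 : Y 0 t != 0 by rewrite -YE L0.
have d1 j : derive1 (Y 0) t * d t 0 j + Y 0 t * derive1 d t 0 j =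
    derive1 (Y (lift ord0 j)) t.
  rewrite (derive1_coord Wt _ _ sd) -(derive1M Wt (sY 0) (sdj j)).
  by apply: near_eq_derive1; apply: (near_in oW Wt) => s; exact: aE.
have d2 : derive1n 2 (Y 0) t * d t 0 k + 2 * (derive1 (Y 0) t * derive1 d t 0 k) +
    Y 0 t * derive1n 2 d t 0 k = derive1n 2 (Y (lift ord0 k)) t.
  rewrite (derive1_coord Wt _ _ sd) (derive1n2_coord oW Wt _ _ sd).
  rewrite -(derive1n2M oW Wt (sY 0) (sdj k)) /derive1n /=.
  apply: near_eq_derive1; apply: (near_in oW Wt) => s Ws.
  apply: near_eq_derive1; apply: (near_in oW Ws) => s' Ws'; exact: aE.
(* [mu] is the logarithmic derivative of [1 + sqnorm (c s)]; this factorization splits it as in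
   [muE]. *)
have sqc s : W s -> 1 + sqnorm (c s) = Y 0 s * Y 0 s * (1 + sqnorm (d s)).
  move=> Ws; rewrite -sqnorm_homog -(sqnorm_mul (homog (c s)) LL).
  by rewrite (dehomogK (L0 s Ws)) sqnormZ sqnorm_homog YE expr2.
have dsq j (x : R -> 'rV[R]_j) : smooth_on W (x : R^o -> 'rV[R]_j) ->
    derive1 (fun s => 1 + sqnorm (x s)) t = 2 * dot (x t) (derive1 x t).
  move=> sx; have sxi i : smooth_on W (fun s : R^o => x s 0 i : R).
    exact: smooth_on_coord.
  transitivity (derive1 (fun s => 1 + \sum_i (x s 0 i * x s 0 i) * 1) t).
    congr (derive1 _ t); apply/funext => s; congr (_ + _).
    by apply: eq_bigr => i _; rewrite mulr1 expr2.
  rewrite (derive1_lincomb Wt) => [|i i']; last first.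
    by apply: CkM => //; exact: sxi.
  rewrite mulr_sumr; apply: eq_bigr => i _.
  by rewrite mulr1 (derive1M Wt (sxi i) (sxi i)) -(derive1_coord Wt _ _ sx); ring.
have sY2 : smooth_on W (fun s => Y 0 s * Y 0 s).
  by move=> i; apply: CkM => //; exact: sY.
have sq1 : smooth_on W (fun s => 1 + sqnorm (d s)).
  move=> i; apply: CkD => //; first exact: Ck_cst.
  apply: Ck_sum => // j; apply: (@Ck_congr _ _ _ _ _ _
    (fun s => d s 0 j * d s 0 j)) => //.
  by apply: CkM => //; exact: sdj.
have e1 : 2 * dot (c t) (derive1 c t) =
    2 * (derive1 (Y 0) t * Y 0 t) * (1 + sqnorm (d t)) +
    Y 0 t * Y 0 t * (2 * dot (d t) (derive1 d t)).
  rewrite -(dsq _ _ sc) -(dsq _ _ sd).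
  transitivity (derive1 (fun s => Y 0 s * Y 0 s * (1 + sqnorm (d s))) t).
    by apply: near_eq_derive1; apply: (near_in oW Wt) => s; exact: sqc.
  rewrite (derive1M Wt sY2 sq1) (derive1M Wt (sY 0) (sY 0)); ring.
have s0 := lt0r_neq0 (sqnorm_homog_gt0 (d t)).
have muE : mu = 2 * derive1 (Y 0) t / Y 0 t +
    2 * dot (d t) (derive1 d t) / (1 + sqnorm (d t)).
  by rewrite /mu e1 (sqc t Wt); field; rewrite a0 s0.
(* In [d2] the terms in [d] cancel, as [Y 0] satisfies the equation too. What remains is
   [Y0 d'' = (mu Y0 - 2 Y0') d']. *)
move: d2; rewrite !Y2 -d1 -/d => d2.
apply: (mulfI a0); apply/eqP; rewrite -subr_eq0; apply/eqP.
move: d2 => /eqP; rewrite -subr_eq0 => /eqP d2; rewrite -[RHS]d2 muE.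
by field; rewrite a0 s0.
Qed.

End geodesics.

(** * Induced maps send geodesics to geodesics *)

Section induced_geodesics.
Context {R : realType} {m n : nat} {r : R} (r0 : 0 < r).
Context {e1 : equiv_rel (sphere m r)} {e2 : equiv_rel (sphere n r)}.
Context {G1 : seq 'M[R]_m.+1} {G2 : seq 'M[R]_n.+1}.
Context (q1 : isometric_quotient e1 G1) (q2 : isometric_quotient e2 G2).
Local Notation S := (sphere_quotient e1).
Local Notation M := (sphere_quotient e2).
Context {E : 'M[R]_(m.+1, n.+1)} (EE : E *m E^T = 1%:M).
Context {f : S -> M}.
Hypothesis fE : forall (x : sphere m r) (y : sphere n r),
  val y = val x *m E -> f (qproj e1 x) = qproj e2 y.

Lemma induced_geodesic (I : set R) (g : R -> S) :
  geodesic I g -> geodesic I (f \o g).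
Proof.
move=> [oI iI Hg]; split => // C W c.
have mS := sphere_quotient_smooth r0 q1.
(* Around each time the curve stays in one chart [B] of the source and in the domain of one branch
   [G]. *)
have loc t : W t -> exists (W' : set R^o) (B : @orthogonal_frame R m.+1) G,
  [/\ open W', W' t, W' `<=` W, G \in G2 &
   [/\ forall s, W' s -> c s = chart_map (E := E) B G C (coord (M := S) B (g s)),
       forall s, W' s -> 0 < (homog (coord (M := S) B (g s)) *m
                              lift_mx (E := E) B G C) 0 0,
       smooth_on W' (coord (M := S) B \o g : R^o -> 'rV[R]_m)
     & projective_line (coord (M := S) B \o g) t]].
  move=> [It /= Ct]; have [B Bt] := patch_cover r0 (g t).
  have [oW sW odeW] := Hg B.
  have WB : (I `&` g @^-1` patch (M := S) B) t by [].
  have /(rep_domP r0 q2 EE fE)[G GG Dt] :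
      rep_dom setT f B C (coord (M := S) B (g t)).
    exact: rep_dom_coord mS Bt Ct.
  pose D := chart_dom (E := E) B G C.
  have oD : open D by exact: chart_dom_open.
  pose W' : set R^o := [set s | (I `&` g @^-1` patch (M := S) B) s /\
    D (coord (M := S) B (g s))].
  have W'E s : W' s -> c s = chart_map (E := E) B G C (coord (M := S) B (g s))
      /\ W s.
    move=> [[Is Bs] Ds]; have := rep_chart_map r0 q2 EE fE GG Ds.
    have gE : par (m := S) B (coord (M := S) B (g s)) = g s by exact: par_coord.
    rewrite /rep /comp gE => cE; split => //; split => //.
    have : rep_dom setT f B C (coord (M := S) B (g s)).
      by apply/(rep_domP r0 q2 EE fE); exists G.
    by move=> [_ [_]]; rewrite /preimage /mkset gE.
  exists W', B, G; split => //.
  - apply: openP => s [Ws Ds].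
    have nW : \forall x \near (s : R^o), (I `&` g @^-1` patch (M := S) B) x.
      exact: near_open.
    have nD : \forall x \near (s : R^o), D (coord (M := S) B (g x)).
      exact: (smooth_on_continuous sW Ws) _ (near_open oD Ds).
    by apply: filterS2 nW nD.
  - by move=> s /W'E[].
  - split.
    + by move=> s /W'E[].
    + by move=> s [_ []].
    + by move=> k; apply: Ck_local => s [Ws _]; exists (I `&` g @^-1` patch (M := S) B).
    + by apply/(geodesic_eq e1 B _ _ r0) => k; exact: odeW.
split.
- apply: openP => t /loc[W' [B [G [oW' W't W'W _ _]]]].
  by have : \forall s \near (t : R^o), W' s by [exact: near_open]; exact: filterS.
- apply: smooth_on_local => t /loc[W' [B [G [oW' W't W'W _ [cE c0 sc _]]]]].
  exists W' => //; apply: (smooth_on_congr oW' (fun s Ws => esym (cE s Ws))).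
  by apply: smooth_on_dehomog => // s /c0; exact: lt0r_neq0.
- move=> t /loc[W' [B [G [oW' W't W'W GG [cE c0 sc Pc]]]]].
  apply/(geodesic_eq e2 C _ _ r0).
  have P := projective_line_map oW' W't sc (lift_mx_orth q2 EE B C GG)
    (fun s Ws => lt0r_neq0 (c0 s Ws)) Pc.
  have ncE : \forall s \near t,
      dehomog (homog ((coord (M := S) B \o g) s) *m lift_mx (E := E) B G C) = c s.
    by apply: (near_in oW' W't) => s /cE ->.
  have d1 := near_eq_derive1 ncE.
  have d2 : derive1n 2 (fun s =>
      dehomog (homog ((coord (M := S) B \o g) s) *m lift_mx (E := E) B G C)) t =
    derive1n 2 c t.
    rewrite /derive1n /=; apply: near_eq_derive1; apply: (near_in oW' W't) => s Ws.
    by apply: near_eq_derive1; apply: (near_in oW' Ws) => s' /cE ->.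
  by move=> k; have := P k; rewrite d1 d2 (nbhs_singleton ncE).
Qed.

(** For charts centred at corresponding points the lift matrix fixes [homog 0], so the branch is
    defined at 0 and sends it to 0. *)
Lemma chart_dom0 (B : @orthogonal_frame R m.+1) G (C : @orthogonal_frame R n.+1) :
  gnomonic r (sval B) 0 *m E *m G = gnomonic r (sval C) 0 ->
  chart_dom (E := E) B G C 0.
Proof.
move=> BC; have h0 : homog 0 *m lift_mx (E := E) B G C = homog 0.
  have := congr1 (fun z => z *m (sval C)^T) BC.
  rewrite gnomonic_mul_tr ?frameE// gnomonicE -!scalemxAl /gscale !sqnorm0.
  rewrite /lift_mx !mulmxA; apply: scalerI.
  by rewrite addr0 sqrtr1 divr1 gt_eqF.
split; first by rewrite sqnorm0.
  by rewrite h0 homog0.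
by rewrite /chart_map h0 homogK sqnorm0.
Qed.

End induced_geodesics.

(** * Real projective spaces *)

Section projective_space.
Context {R : realType} {n : nat} {r : R} (r0 : 0 < r).

Lemma antipodal_quotient : isometric_quotient (antipodal_rel n r)
  [:: 1%:M : 'M[R]_n.+1; - 1%:M].
Proof.
split.
- by move=> x y; rewrite /= mulmx1 mulmxN mulmx1 orbF.
- move=> G; rewrite !inE => /orP[]/eqP->; first by rewrite mul1_tr1.
  by rewrite linearN /= mulNmx mulmxN opprK mul1_tr1.
- move=> G; rewrite !inE => /orP[]/eqP->; first by left.
  by right=> x; rewrite mulmxN mulmx1 dotNr dotxx oppr_le0 sqnorm_ge0.
Qed.

(** The squared length of [(1 - t) x + t z], where [x] and [z] have squared length [b] and scalar
    product [a]: the segment avoids the origin. *)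
Lemma segment_norm_gt0 (t a b : R) : 0 <= t -> t <= 1 -> 0 <= a -> 0 < b ->
  0 < (1 - t) ^+ 2 * b + 2 * ((1 - t) * (t * a)) + t ^+ 2 * b.
Proof.
move=> t0 t1 a0 b0.
have h1 : 0 <= (1 - t) * (t * a) by rewrite !mulr_ge0// subr_ge0.
have h2 : 0 < ((1 - t) ^+ 2 + t ^+ 2) * b.
  by rewrite mulr_gt0//; have := sqr_ge0 (1 - 2 * t); nra.
by move: h1 h2; move: (_ * (t * a)) => c; nra.
Qed.

(** Of the representatives [y] and [- y], one makes an angle of at most a right angle with [x0]; the
    segment from [x0] to it avoids the origin, and [qnorm] maps it to a path. *)
Lemma RPn_connected : connected [set: RPn n r].
Proof.
pose e := antipodal_rel n r.
have [x0 _] : exists x0 : sphere n r, True.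
  by exists (gnomonic_pt r (id_frame n.+1) 0).
have path (y : sphere n r) : exists A : set (RPn n r),
    [/\ connected A, A (qproj e x0) & A (qproj e y)].
  have [z [zE xz]] : exists z : sphere n r, qproj e z = qproj e y /\
      0 <= dot (val x0) (val z).
    have [xy|xy] := lerP 0 (dot (val x0) (val y)); first by exists y.
    have yr : sqnorm (- val y) == r ^+ 2.
      by rewrite -scaleN1r sqnormZ sqrrN expr1n mul1r sphereE.
    exists (sphere_pt yr); split; last by rewrite dotNr oppr_ge0 ltW.
    apply/(qproj_eqP antipodal_quotient); exists (- 1%:M).
      by rewrite !inE eqxx orbT.
    by rewrite mulmxN mulmx1 opprK.
  pose g (t : R) := (1 - t) *: val x0 + t *: val z.
  have g0 t : t \in `[0, 1] -> g t != 0.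
    rewrite in_itv /= => /andP[t0 t1]; rewrite -sqnorm_eq0 sqnormD !sqnormZ.
    rewrite dotZl dotZr !sphereE gt_eqF//.
    exact: segment_norm_gt0 t0 t1 xz (exprn_gt0 2 r0).
  exists ((fun t => qnorm (e := e) (g t)) @` `[0, 1]); split.
  - apply: connected_continuous_connected; first exact: segment_connected.
    apply: continuous_in_subspaceT => t /set_mem t01.
    have cg : {for t, continuous g}.
      apply: continuousD; apply: cvgZr_tmp; last exact: cvg_id.
      by apply: cvgB; [exact: cvg_cst|exact: cvg_id].
    exact: (continuous_comp cg (qnorm_continuous r0 (g0 t t01))).
  - exists 0; first by rewrite /= in_itv /= lexx ler01.
    by rewrite /g subr0 scale1r scale0r addr0 qnorm_sphere.
  - exists 1; first by rewrite /= in_itv /= lexx ler01.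
    by rewrite /g subrr scale1r scale0r add0r qnorm_sphere.
pose A y := sval (cid (path y)).
have -> : [set: RPn n r] = \bigcup_(y in [set: sphere n r]) A y.
  apply/seteqP; split => // p _; have [y ->] := @qproj_surj _ _ _ e p.
  by exists y => //; rewrite /A; case: cid => ? [].
apply: bigcup_connected => [|y _]; last by rewrite /A; case: cid => ? [].
by exists (qproj e x0) => y _; rewrite /A; case: cid => ? [].
Qed.

End projective_space.

(** * Quaternions *)

Section quaternionic_quotient.
Context {R : realType}.

(** The rows are the products of 1, i, j, k with [q]. *)
Definition qmulr_mx (q : 'rV[R]_4) : 'M[R]_4 :=
  \matrix_(i < 4) [:: q;
    quat (- q 0 1) (q 0 0) (- q 0 3%:R) (q 0 2%:R);
    quat (- q 0 2%:R) (q 0 3%:R) (q 0 0) (- q 0 1);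
    quat (- q 0 3%:R) (- q 0 2%:R) (q 0 1) (q 0 0)]`_i.

Lemma quat_inj (a b c d a' b' c' d' : R) :
  quat a b c d = quat a' b' c' d' -> [/\ a = a', b = b', c = c' & d = d'].
Proof.
move=> e; have := congr1 (fun p : 'rV[R]_4 => (p 0 0, p 0 1, p 0 2%:R, p 0 3%:R)) e.
by rewrite !mxE /= => -[].
Qed.

Lemma dot_quat (a b c d a' b' c' d' : R) :
  dot (quat a b c d) (quat a' b' c' d') = a * a' + b * b' + c * c' + d * d'.
Proof. by rewrite /dot !big_ord_recr big_ord0 !mxE /= add0r. Qed.

Lemma mul_qmulr_mx (p q : 'rV[R]_4) : p *m qmulr_mx q = qmul p q.
Proof.
rewrite (quatE p) {2}(quatE q) qmul_quat; apply/rowP => j.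
rewrite mxE !big_ord_recr big_ord0 !mxE /= {1}(quatE q).
by case: j => -[|[|[|[|//]]]] hj /=; rewrite !mxE /=; ring.
Qed.

Lemma dot_qmul (p q p' : 'rV[R]_4) :
  dot (qmul p q) (qmul p' q) = sqnorm q * dot p p'.
Proof.
rewrite (quatE p) (quatE q) (quatE p') !qmul_quat !dot_quat sqnorm_quat; ring.
Qed.

(** [p i], [p j], [p k] are orthogonal to [p], so only the real part of [q] counts. It is at most 0
    for every element of [Q8] except 1, hence the right-angle condition. *)
Lemma dot_qmulr (p q : 'rV[R]_4) : dot p (qmul p q) = q 0 0 * sqnorm p.
Proof.
rewrite (quatE p) (quatE q) qmul_quat dot_quat sqnorm_quat !mxE /=; ring.
Qed.

Lemma qmulr_mx_orth (q : 'rV[R]_4) : sqnorm q = 1 ->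
  qmulr_mx q *m (qmulr_mx q)^T = 1%:M.
Proof.
move=> q1; apply/matrixP => i j.
have -> : (qmulr_mx q *m (qmulr_mx q)^T) i j =
    dot (delta_mx 0 i *m qmulr_mx q) (delta_mx 0 j *m qmulr_mx q).
  by rewrite -!rowE mxE; apply: eq_bigr => k _; rewrite !mxE.
by rewrite !mul_qmulr_mx dot_qmul q1 mul1r dot_delta !mxE eqxx eq_sym.
Qed.

Lemma Q8_sqnorm : {in Q8, forall q : 'rV[R]_4, sqnorm q = 1}.
Proof. by apply: Q8_ind; rewrite sqnorm_quat; ring. Qed.

Lemma Q8_quotient (r : R) :
  isometric_quotient (Q8_rel r) [seq qmulr_mx q | q <- Q8].
Proof.
split.
- move=> x y; rewrite has_map.
  have -> : Q8_rel r x y = has (fun q => val y == qmul (val x) q) Q8 by [].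
  by apply: eq_has => q; rewrite /= mul_qmulr_mx.
- by move=> _ /mapP[q /Q8_sqnorm q1 ->]; exact: qmulr_mx_orth.
- have Q1 : qmulr_mx (quat 1 0 0 0) = 1%:M.
    apply/row_matrixP => i; rewrite !rowE mul_qmulr_mx qmul1 mulmx1//.
  move=> _ /mapP[q qQ ->]; have [q0|q0] := lerP (q 0 0) 0.
    right=> x; rewrite mul_qmulr_mx dot_qmulr.
    by rewrite mulr_le0_ge0// sqnorm_ge0.
  left; move: q qQ q0; apply: Q8_ind; rewrite ?Q1// mxE /= ?ltxx//.
  by rewrite oppr_gt0 ltr10.
Qed.

Definition imq_mx : 'M[R]_(3, 4) :=
  \matrix_(i < 3) [:: quat 0 1 0 0; quat 0 0 1 0; quat 0 0 0 1]`_i.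

Lemma mul_imq_mx (p : 'rV[R]_3) : p *m imq_mx = imq p.
Proof.
have -> : p = \row_i [:: p 0 0; p 0 1; p 0 2%:R]`_i.
  apply/rowP => i; rewrite mxE.
  by case: i => -[|[|[|//]]] hi /=; congr (p 0 _); exact/val_inj.
apply/rowP => j; rewrite mxE !big_ord_recr big_ord0 !mxE /=.
by case: j => -[|[|[|[|//]]]] hj /=; ring.
Qed.

Lemma imq_mx_orth : imq_mx *m imq_mx^T = 1%:M.
Proof.
apply/matrixP => i j; rewrite mxE !big_ord_recr big_ord0 !mxE /=.
case: i => -[|[|[|//]]] hi; case: j => -[|[|[|//]]] hj; rewrite !mxE /=; ring.
Qed.

Lemma imq_inj : injective (@imq R).
Proof.
move=> p q /quat_inj[_ p0 p1 p2]; apply/rowP => i.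
case: i => -[|[|[|//]]] hi.
- by have -> : Ordinal hi = 0 by exact/val_inj.
- by have -> : Ordinal hi = 1 by exact/val_inj.
- by have -> : Ordinal hi = 2%:R by exact/val_inj.
Qed.

End quaternionic_quotient.

(** Turns an equality of vectors in the target chart into one in the ambient space: [K] stands for
    the differential of the parametrization, [A0] and [A1] for Jacobians of the map, [N0] and [N1]
    for those of its lifts. *)
Lemma mulmx_factor (R : pzRingType) l m n k (v0 v1 : 'M[R]_(l, m))
    (A0 A1 : 'M[R]_(m, n)) (K : 'M[R]_(n, k)) N0 N1 :
  A0 *m K = N0 -> A1 *m K = N1 -> v0 *m A0 = v1 *m A1 -> v0 *m N0 = v1 *m N1.
Proof. by move=> <- <- vA; rewrite !mulmxA vA. Qed.

(** * The immersion of the projective plane *)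

Section main.
Context {R : realType}.

Lemma radius_gt0 : 0 < @radius R.
Proof. by rewrite mulr_gt0// sqrtr_gt0. Qed.

Let r0 := radius_gt0.
Let qR : isometric_quotient (antipodal_rel 2 (@radius R)) _ :=
  antipodal_quotient.
Let qF := Q8_quotient (@radius R).

Lemma phi_induced (x : sphere 2 (@radius R)) (y : sphere 3 (@radius R)) :
  val y = val x *m imq_mx -> phi (qproj (antipodal_rel 2 radius) x) =
    qproj (Q8_rel radius) y.
Proof.
move=> yx; rewrite -[qproj _ x]/(RP2_class x) phiE; congr qproj.
by apply/val_inj; rewrite /= yx mul_imq_mx.
Qed.

Lemma phi_not_injective : ~ injective (@phi R).
Proof.
move=> phi_inj; pose e k : 'rV[R]_3 := radius *: delta_mx 0 k.
have er k : sqnorm (e k) == radius ^+ 2.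
  by rewrite sqnormZ -dotxx dot_delta mxE !eqxx mulr1.
have : phi (qproj (antipodal_rel 2 radius) (sphere_pt (er 0))) =
    phi (qproj (antipodal_rel 2 radius) (sphere_pt (er 1))).
  rewrite !(f_qproj imq_mx_orth phi_induced).
  apply/(qproj_eqP qF); exists (qmulr_mx (quat 0 0 0 (-1))).
    by apply: map_f; rewrite !inE eqxx !orbT.
  rewrite /= mul_qmulr_mx !mul_imq_mx /imq !mxE /= qmul_quat.
  by congr quat; ring.
move=> /phi_inj /(qproj_eqP qR)[G].
have r1 := lt0r_neq0 r0.
rewrite !inE => /orP[]/eqP-> /=; rewrite ?mulmxN mulmx1;
  move=> /(congr1 (fun z : 'rV[R]_3 => z 0 0)); rewrite !mxE /=.
  by move=> /eqP; rewrite mulr0 mulr1 eq_sym (negbTE r1).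
by move=> /eqP; rewrite mulr0 mulr1 eq_sym oppr_eq0 (negbTE r1).
Qed.

Lemma phi_totally_geodesic : totally_geodesic_immersion (@phi R).
Proof.
have pm : preserves_metric (@phi R).
  exact: (induced_preserves_metric r0 qF imq_mx_orth phi_induced).
have sm : msmooth_on setT (@phi R).
  exact: (induced_msmooth r0 qF imq_mx_orth phi_induced).
have rR : riemannian_manifold (@RP2 R) := sphere_quotient_riemannian r0 qR.
split => //.
- exact: RPn_connected r0.
- exact: (sphere_quotient_riemannian r0 qF).
- by split => // i j u; exact: preserves_metric_row_free.
- by move=> I g; exact: (induced_geodesic r0 qR qF imq_mx_orth phi_induced).
Qed.

Lemma phi_inextendable : inextendable (@phi R).
Proof.
move=> S' f' j [[sS' _ _ _ _] cS' _ _ _] _ [ij lij _].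
have p0 : RP2 := qproj (antipodal_rel 2 (@radius R))
  (gnomonic_pt radius (id_frame 3) 0).
apply: (compact_local_isometry p0) => //.
exact: (quotient_compact r0).
Qed.

(* If [phi [x] = phi [y]] with [y = x q] and [q] imaginary, then [q] is
   tangent to [x], and its image is the class of the tangent vector [q q = - 1]
   at [y], which is not imaginary. *)
Lemma phi_compatible : compatible (@phi R).
Proof.
move=> p p' [phipp' tpp']; have phipp'' := phipp'.
have [x xE] := @qproj_surj _ _ _ (antipodal_rel 2 (@radius R)) p.
have [y yE] := @qproj_surj _ _ _ (antipodal_rel 2 (@radius R)) p'.
rewrite xE yE; move: phipp'; rewrite xE yE !(f_qproj imq_mx_orth phi_induced).
move=> /(qproj_eqP qF)[_ /mapP[q qQ ->]] /= yxq.
have yxq' : imq (val y) = qmul (imq (val x)) q.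
  by rewrite -mul_qmulr_mx -!mul_imq_mx -yxq.
apply/(qproj_eqP qR).
have [q1|q1|q0] : [\/ q = quat 1 0 0 0, q = quat (-1) 0 0 0 | q 0 0 = 0].
- by move: q qQ {yxq yxq'}; apply: Q8_ind; rewrite ?mxE /=;
    by [constructor 1|constructor 2|constructor 3].
- exists 1%:M; first by rewrite inE eqxx.
  by apply: imq_inj; rewrite mulmx1 yxq' q1 qmul1.
- exists (- 1%:M); first by rewrite !inE eqxx orbT.
  apply: imq_inj; rewrite mulmxN mulmx1 yxq' q1 /imq qmul_quat !mxE.
  by congr quat; ring.
exfalso.
pose q3 : 'rV[R]_3 := \row_i [:: q 0 1; q 0 2%:R; q 0 3%:R]`_i.
have q3E : imq q3 = q by rewrite [RHS]quatE q0 /imq !mxE.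
(* The real part of [imq x * q] is minus this scalar product, and it vanishes because [imq y] is
   imaginary. *)
have q3x : dot q3 (val x) = 0.
  have := congr1 (fun z : 'rV[R]_4 => z 0 0) yxq'.
  rewrite -q3E /imq qmul_quat !mxE /= /dot !big_ord_recr big_ord0 !mxE /=.
  have -> : widen_ord (leqnSn 2) (widen_ord (leqnSn 1) ord_max) = 0 :> 'I_3.
    exact/val_inj.
  have -> : widen_ord (leqnSn 2) ord_max = 1 :> 'I_3 by exact/val_inj.
  have -> : ord_max = 2%:R :> 'I_3 by exact/val_inj.
  move=> e; apply: oppr_inj; rewrite oppr0 [RHS]e; ring.
have [B0 [B0x B0p]] := frame_patch r0 (e := antipodal_rel 2 radius) x.
have [B1 [B1y B1p]] := frame_patch r0 (e := antipodal_rel 2 radius) y.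
pose Y := sphere_pt (sphere_E imq_mx_orth y).
have [C [CY Cp]] := frame_patch r0 (e := Q8_rel radius) Y.
(* The charts being centred at [x], [y] and their common image, all source coordinates are 0. The
   image chart is reached from [x] through the branch [q], from [y] through the branch 1. *)
have D0 : chart_dom (E := imq_mx) B0 (qmulr_mx q) C 0.
  by apply: (chart_dom0 r0); rewrite B0x CY /= yxq.
have D1 : chart_dom (E := imq_mx) B1 (qmulr_mx (quat 1 0 0 0)) C 0.
  by apply: (chart_dom0 r0); rewrite B1y CY /= mul_qmulr_mx qmul1.
have G0 : qmulr_mx q \in [seq qmulr_mx q | q <- Q8] by exact: map_f.
have G1 : qmulr_mx (quat 1 0 0 0) \in [seq qmulr_mx q | q <- @Q8 R].
  by apply: map_f; rewrite inE eqxx.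
have J0 := jacobian_induced r0 qF imq_mx_orth phi_induced G0 D0.
have J1 := jacobian_induced r0 qF imq_mx_orth phi_induced G1 D1.
(* The components of [q3] in the chart at [x]. The first row of the frame is [x / r], so by [q3x]
   the component left out is 0. *)
pose v0 : 'rV[R]_2 := \row_i (q3 *m (sval B0)^T) 0 (lift ord0 i).
have v0E : atinf v0 *m sval B0 = q3.
  have -> : atinf v0 = q3 *m (sval B0)^T.
    apply: rowSP => [|i]; last by rewrite atinfS mxE.
    rewrite atinf0 -dot_delta -(dot_mul _ _ (frameE B0)) -mulmxA.
    rewrite (mulmx1C (frameE B0)) mulmx1; apply: (mulfI (lt0r_neq0 r0)).
    by rewrite -dotZr -gnomonic0 B0x q3x mulr0.
  by rewrite -mulmxA (mulmx1C (frameE B0)) mulmx1.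
have ball0 k : sqnorm (0 : 'rV[R]_k) < 1 by rewrite sqnorm0.
have phiE0 : phi p = qproj (Q8_rel radius) Y.
  by rewrite phipp'' yE; exact: (f_qproj imq_mx_orth phi_induced).
have pB0 : patch (M := RP2) B0 p by rewrite xE -B0p; exists 0; [exact: ball0|].
have pB1 : patch (M := RP2) B1 p' by rewrite yE -B1p; exists 0; [exact: ball0|].
have pC : patch (M := flagR3) C (phi p).
  by rewrite phiE0 -Cp; exists 0; [exact: ball0|].
have sR : smooth_manifold (@RP2 R) := sphere_quotient_smooth r0 qR.
have sF : smooth_manifold (@flagR3 R) := sphere_quotient_smooth r0 qF.
have sphi : msmooth_on setT (@phi R).
  exact: (induced_msmooth r0 qF imq_mx_orth phi_induced).
have [w wT wC] := @tangent_image_lift R RP2 flagR3 phi p B0 C v0 sR sF sphi pB0 pC.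
rewrite tpp' in wT; have [_ [v _ /(_ B1 C pB1)]] := wT.
rewrite -phipp'' => /(_ pC); rewrite wC.
have -> : coord (M := RP2) B0 p = 0 by rewrite xE -B0p; exact: (coord_qproj r0 qR).
have -> : coord (M := RP2) B1 p' = 0 by rewrite yE -B1p; exact: (coord_qproj r0 qR).
have repE : rep phi B1 C 0 = rep phi B0 C 0.
  by rewrite /rep /comp B0p B1p -xE -yE phipp''.
(* After transport along [repE], [J0] and [J1'] end with the same differential, the [K] of
   [mulmx_factor]. *)
have J1' := eq_ind _ (fun z => jacobian (rep phi B1 C) 0 *m
  jacobian (gnomonic radius (sval C)) z = _) J1 _ repE.
move=> /(mulmx_factor J0 J1').
(* The left side becomes a positive multiple of [q q], while the right side lies in the image of
   [imq]; the real parts are compared. *)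
rewrite !mulmxA (jacobian_gnomonic (sval B0) 0 v0 r0) -!scalemxAl.
have d0 : dot 0 v0 = 0 by rewrite -(scale0r 0) dotZl mul0r.
rewrite d0 mul0r scale0r subr0 v0E mul_imq_mx !mul_qmulr_mx qmul1 mul_imq_mx.
rewrite q3E => /(congr1 (fun z : 'rV[R]_4 => z 0 0)).
have qq : qmul q q 0 0 = - sqnorm q.
  by rewrite (quatE q) q0 qmul_quat sqnorm_quat mxE /=; ring.
have imq0 h : imq h 0 0 = 0 :> R by rewrite mxE.
rewrite imq0 mxE qq (Q8_sqnorm qQ) mulrN1 => /eqP; rewrite oppr_eq0.
by rewrite gt_eqF// gscale_gt0.
Qed.

End main.

Theorem proposition5p2 (R : realType) :
  [/\ ~ injective (@phi R),
      inextendable (@phi R),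
      compatible (@phi R)
    & totally_geodesic_immersion (@phi R)].
Proof.
split.
- exact: phi_not_injective.
- exact: phi_inextendable.
- exact: phi_compatible.
- exact: phi_totally_geodesic.
Qed.
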